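(* Fix a field $\mathbb{F}$ and $0<c<1$. For each $n$, let $T\subseteq \mathbb{F}^n$ be a $c$-dispersed set and let $B_1,\dots,B_n\subseteq T$ be independent random bases of $\mathbb{F}^n$, where each $B_i$ is chosen uniformly at random from the collection $\{B\subseteq T\mid B\text{ is a basis of }\mathbb{F}^n\}$. Then, with probability $1-o(1)$ as $n\to\infty$, the multi-set $B_1\cup\dots\cup B_n$ can be partitioned into $n$ bases of $\mathbb{F}^n$ which are transversal with respect to $B_1,\dots,B_n$.
   Context: For $0<c<1$, a set $T\subseteq\mathbb{F}^n$ is called $c$-dispersed if every linear subspace $V\subseteq\mathbb{F}^n$ satisfies $|V\cap T|\leq c^{n-\dim V}\cdot|T|$. A basis $B\subseteq B_1\cup\dots\cup B_n$ (a sub-multiset of the multi-set union) is called transversal with respect to $B_1,\dots,B_n$ if it contains exactly one vector from each of $B_1,\dots,B_n$, where copies of a vector occurring in several bases are distinguished by which $B_i$ they come from. *)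

(* Defs.v *)
From HB Require Import structures.
From mathcomp Require Import all_boot all_order all_algebra finmap.
From mathcomp Require Import boolp classical_sets reals topology normedtype.

Set Implicit Arguments.
Unset Strict Implicit.
Unset Printing Implicit Defensive.

Import Order.TTheory GRing.Theory Num.Theory numFieldNormedType.Exports.
Local Open Scope fset_scope.
Local Open Scope ring_scope.

Definition dispersed (R : realType) (F : fieldType) (n : nat) (c : R)
    (T : {fset 'rV[F]_n}) : Prop :=
  forall V : {vspace 'rV[F]_n},
    #|` [fset v in T | v \in V] |%:R <= c ^+ (n - \dim V) * #|` T |%:R.

Definition is_basis (F : fieldType) (n : nat) (B : {fset 'rV[F]_n}) : bool :=
  basis_of {:'rV[F]_n} (enum_fset B).

Definition bases_in (F : fieldType) (n : nat) (T : {fset 'rV[F]_n}) :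
    {fset {fset 'rV[F]_n}} :=
  [fset B in fpowerset T | is_basis B].

(* The multi-set union of the B_i: the copy of v coming from B_i is (i, v). *)
Definition multi_union (F : fieldType) (n : nat)
    (B : 'I_n -> {fset 'rV[F]_n}) : {fset 'I_n * 'rV[F]_n} :=
  \big[fsetU/fset0]_(i < n) [fset (i, v) | v in B i].

(* The vectors of X are listed with multiplicity, so that a sub-multiset
   containing two copies of the same vector is not a basis. *)
Definition is_multiset_basis (F : fieldType) (n : nat)
    (X : {fset 'I_n * 'rV[F]_n}) : bool :=
  basis_of {:'rV[F]_n} [seq x.2 | x <- enum_fset X].

Definition is_transversal (F : fieldType) (n : nat)
    (B : 'I_n -> {fset 'rV[F]_n}) (X : {fset 'I_n * 'rV[F]_n}) : Prop :=
  X `<=` multi_union B /\ forall i : 'I_n, exists! v, (i, v) \in X.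

Definition transversal_basis_partition (F : fieldType) (n : nat)
    (B : 'I_n -> {fset 'rV[F]_n}) : Prop :=
  exists P : 'I_n -> {fset 'I_n * 'rV[F]_n},
    [/\ forall x, (x \in multi_union B) <-> (exists j, x \in P j),
        forall j k, j != k -> [disjoint P j & P k]%fset,
        forall j, is_multiset_basis (P j)
      & forall j, is_transversal B (P j)].

Definition uniform_pmf (R : realType) (K : choiceType) (S : {fset K}) (x : K)
    : R :=
  if x \in S then #|` S |%:R^-1 else 0.

(* The probability that (X_1, ..., X_n) satisfies E, for independent X_i
   uniformly distributed on S: by independence the joint mass function is the
   product of the marginal ones.  Meaningful only for nonempty S. *)
Definition prob_indep_uniform (R : realType) (K : choiceType) (n : nat)
    (S : {fset K}) (E : ('I_n -> K) -> Prop) : R :=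
  \sum_(X : {ffun 'I_n -> S} | `[< E (fun i => fsval (X i)) >])
    \prod_(i < n) uniform_pmf R S (fsval (X i)).

(* Main.v *)
Require Import Defs.
From HB Require Import structures.
From mathcomp Require Import all_boot all_order all_algebra finmap.
From mathcomp Require Import zify ring lra.
From mathcomp Require Import reals.

(** A uniformly random basis in random order is a uniform n-tuple of vectors of
    T conditioned on an event of probability at least some delta(c) > 0, so one
    may count n x n matrices over T whose rows are bases.  Keep the first N =
    n/2 rows in their random order and look at the spans W_1, ..., W_n of the
    first k entries of the columns.  For k <= N a clash (the next entry of column j
    lies in W_j) is exponentially unlikely.  For k > N row k is permuted so
    that its j-th entry avoids W_j.  By Hall's theorem this fails only if more
    than n - |J| of its entries lie in the intersection of the W_j, j in J, for
    some J; this is unlikely when J is small since most entries would lie in a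
    single hyperplane, and when J is large as soon as any g of the W_j meet in
    codimension at least d.  The latter holds simultaneously for all choices of
    the permutations made so far: otherwise d of the columns already determine
    an intersection E of codimension less than d, E can be described by
    n^(O(dn)) codes, and each of about g further columns must have its first N
    random entries generating, together with E, a proper subspace.  That has
    probability about c^(gN), which beats the number of codes and delta^(-n).
    The parameters are d = 2 s^2 and g = s^4 with s about n^(1/5). *)

Set Implicit Arguments.
Unset Strict Implicit.
Unset Printing Implicit Defensive.
Import Order.TTheory GRing.Theory Num.Theory.
Local Open Scope ring_scope.

(** * Counting functions and weighted sums over subsets *)

Lemma card_family_set (K T : finType) (S : K -> {set T}) :
  #|[set y : {ffun K -> T} | [forall k, y k \in S k]]| = (\prod_k #|S k|)%N.
Proof.
have -> : (\prod_k #|S k|)%N = foldr muln 1%N [seq #|S x| | x : K].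
  by rewrite foldrE big_image.
rewrite -card_family; apply: eq_card => y; rewrite inE.
by apply/forallP/familyP => h k; have := h k.
Qed.

(* Double counting of the pairs (x, y) that agree outside Fr. *)
Lemma prod_count (R : numDomainType) (K T : finType) (Fr : {set K})
    (Q : pred {ffun K -> T}) (A : K -> {ffun K -> T} -> {set T}) (a : R) :
  (0 < #|T|)%N -> 0 <= a ->
  (forall x y : {ffun K -> T},
     (forall k, k \notin Fr -> x k = y k) -> Q x = Q y) ->
  (forall x y : {ffun K -> T}, (forall k, k \notin Fr -> x k = y k) ->
     forall k, k \in Fr -> A k x = A k y) ->
  (forall k x, Q x -> k \in Fr -> #|A k x|%:R <= a * #|T|%:R) ->
  #|[set x | Q x && [forall k in Fr, x k \in A k x]]|%:R
    <= a ^+ #|Fr| * #|[set x | Q x]|%:R.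
Proof.
move=> T0 a0 Qloc Aloc Aub.
pose ag (x y : {ffun K -> T}) := [forall k, (k \notin Fr) ==> (x k == y k)].
have agP (x y : {ffun K -> T}) : reflect (forall k, k \notin Fr -> x k = y k) (ag x y).
  apply: (iffP forallP) => h k; first by move=> kF; apply/eqP/(implyP (h k)).
  by apply/implyP => kF; apply/eqP/h.
set G := [set x | _ && _]; set H := [set x | _].
have card_ag x : #|[set y | ag x y]| = (#|T| ^ #|Fr|)%N.
  pose S k := if k \in Fr then [set: T] else [set x k].
  rewrite (_ : [set y | _] = [set y : {ffun K -> T} | [forall k, y k \in S k]]); last first.
    apply/setP => y; rewrite !inE; apply/agP/forallP => h k.
      by rewrite /S; case: ifPn => kF; rewrite !inE // h.
    by move=> /negbTE kF; have := h k; rewrite /S kF inE => /eqP.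
  rewrite card_family_set (bigID (mem Fr)) /= [X in (_ * X)%N]big1 ?muln1.
    by rewrite -prod_nat_const; apply: eq_bigr => k kF; rewrite /S kF cardsT.
  by move=> k /negbTE kF; rewrite /S kF cards1.
(* Each [x] agrees outside [Fr] with exactly [#|T| ^ #|Fr|] functions, and all of them stay in [H]
   because [Q] does not read [Fr]. *)
have swap : (#|G| * #|T| ^ #|Fr| = \sum_(y in H) #|[set x in G | ag x y]|)%N.
  transitivity (\sum_(x in G) \sum_(y | ag x y) 1)%N.
    rewrite -sum_nat_const; apply: eq_bigr => x _.
    by rewrite sum1_card -(card_ag x) cardsE.
  rewrite (exchange_big_dep (mem H)) /=; last first.
    by move=> x y; rewrite !inE => /andP[Qx _] /agP/Qloc <-.
  apply: eq_bigr => y _; rewrite sum1_card -[LHS]cardsE.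
  by apply: eq_card => x; rewrite !inE.
have T0' : 0 < (#|T| ^ #|Fr|)%N%:R :> R by rewrite ltr0n expn_gt0 T0.
rewrite -(ler_pM2r T0') -natrM swap natr_sum -mulrA [(#|H|%:R * _)]mulrC mulrA.
rewrite mulr_natr -sumr_const; apply: ler_sum => y; rewrite inE => Qy.
pose S k := if k \in Fr then A k y else [set y k].
apply: (@le_trans _ _ #|[set x : {ffun K -> T} | [forall k, x k \in S k]]|%:R).
  rewrite ler_nat; apply/subset_leq_card/fintype.subsetP => x; rewrite !inE.
  move=> /andP[/andP[Qx /forallP h] /agP xy]; apply/forallP => k; rewrite /S.
  case: ifPn => kF; last by rewrite inE xy.
  by rewrite -(Aloc x) //; apply: (implyP (h k)).
rewrite card_family_set (bigID (mem Fr)) /= [X in (_ * X)%N]big1 ?muln1; last first.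
  by move=> k /negbTE kF; rewrite /S kF cards1.
rewrite natr_prod natrX -exprMn -prodr_const; apply: ler_prod => k kF.
by rewrite /S kF ler0n Aub.
Qed.

Lemma sum_sets_exp (R : comPzRingType) (I : finType) (x y : R) :
  \sum_(J : {set I}) x ^+ #|J| * y ^+ #|~: J| = (x + y) ^+ #|I|.
Proof.
rewrite -prodr_const bigA_distr; apply: eq_bigr => J _.
rewrite (bigID (mem J)) /=; congr (_ * _).
  by rewrite -prodr_const; apply: eq_bigr => i ->.
rewrite -prodr_const; apply: eq_big => i; rewrite inE //.
by move=> /negbTE ->.
Qed.

(** * Hall's marriage theorem *)

Section Hall.
Variables (I T : finType).

Definition neighbours (e : {set I * T}) (J : {set I}) : {set T} :=
  [set t | [exists i in J, (i, t) \in e]].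
Definition hall_cond (e : {set I * T}) :=
  [forall J : {set I}, #|J| <= #|neighbours e J|]%N.

Lemma neighboursP (e : {set I * T}) (J : {set I}) t :
  reflect (exists2 i, i \in J & (i, t) \in e) (t \in neighbours e J).
Proof. by rewrite inE; exact: (iffP exists_inP). Qed.

(* Rado's argument: an edge set minimal for Hall's condition has all degrees 1. *)
Theorem hall_matching (e : {set I * T}) : hall_cond e ->
  exists2 f : I -> T, injective f & forall i, (i, f i) \in e.
Proof.
move=> /minset_exists[m /minsetP[hm mmin] sub_me].
have deg1 i x y : (i, x) \in m -> (i, y) \in m -> x = y.
  move=> ix iy; apply/eqP; apply: contraT => xy.
  (* By minimality Hall's condition breaks when the edge [(i, z)] is deleted. The violating set must
     contain [i], since other neighbourhoods are unchanged. *)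
  have bad z : (i, z) \in m -> exists2 J : {set I}, i \notin J &
      (#|neighbours (m :\ (i, z)) (i |: J)| <= #|J|)%N.
    move=> iz; have : ~~ hall_cond (m :\ (i, z)).
      apply/negP => /mmin/(_ (subD1set _ _)) E.
      by move: iz; rewrite -E !inE eqxx.
    rewrite negb_forall => /existsP[J]; rewrite -ltnNge => ltJ.
    have iJ : i \in J.
      apply: contraLR ltJ => iJ; rewrite -leqNgt.
      apply: leq_trans (forallP hm J) _; apply/subset_leq_card/fintype.subsetP => t.
      case/neighboursP => k kJ kt; apply/neighboursP; exists k => //.
      rewrite !inE kt andbT; apply: contraNneq iJ => -[<- _] //.
    exists (J :\ i); first by rewrite !inE eqxx.
    by rewrite finset.setD1K //; move: ltJ; rewrite (cardsD1 i J) iJ.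
  have [J iJ cJ] := bad x ix; have [L iL cL] := bad y iy.
  set X := neighbours _ _ in cJ; set Y := neighbours _ _ in cL.
  have sU : neighbours m (i |: (J :|: L)) \subset X :|: Y.
    apply/fintype.subsetP => t /neighboursP[k]; rewrite !inE.
    have [->|ki] /= := eqVneq k i => [_ kt|kJL kt].
      have [->|tx] := eqVneq t x.
        by apply/orP; right; apply/exists_inP; exists i; rewrite !inE ?eqxx // ix xpair_eqE (negbTE xy) andbF.
      by apply/orP; left; apply/exists_inP; exists i; rewrite !inE ?eqxx // kt xpair_eqE (negbTE tx) andbF.
    case/orP: kJL => kJL; apply/orP; [left|right]; apply/exists_inP; exists k;
      by rewrite !inE ?kJL ?orbT // kt xpair_eqE (negbTE ki).
  have sI : neighbours m (J :&: L) \subset X :&: Y.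
    apply/fintype.subsetP => t /neighboursP[k]; rewrite !inE => /andP[kJ kL] kt.
    have ki : k != i by apply: contraNneq iJ => <-.
    apply/andP; split; apply/exists_inP; exists k;
      by rewrite !inE ?kJ ?kL ?orbT // kt xpair_eqE (negbTE ki).
  (* Submodularity: [X] and [Y] have at most [#|J| + #|L|] elements together, but Hall's condition
     on [i |: (J :|: L)] and on [J :&: L] demands one more. *)
  have h1 := leq_trans (forallP hm _) (subset_leq_card sU).
  have h2 := leq_trans (forallP hm _) (subset_leq_card sI).
  move: h1; rewrite cardsU1 !inE negb_or iJ iL /= => h1.
  have := cardsUI X Y; have := cardsUI J L; lia.
have deg0 i : exists t, (i, t) \in m.
  have := forallP hm [set i]; rewrite cards1 => /card_gt0P[t].
  by case/neighboursP => k /set1P ->; exists t.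
exists (fun i => xchoose (deg0 i)); last first.
  by move=> i; apply: (fintype.subsetP sub_me); exact: (xchooseP (deg0 i)).
(* Two indices with the same partner would have a one-element neighbourhood, as all degrees are
   1. *)
move=> i k eqik; apply/eqP; apply: contraT => ik.
have := forallP hm [set i; k]; rewrite cards2 ik.
rewrite leqNgt ltnS (_ : (_ <= 1)%N) //.
rewrite -(cards1 (xchoose (deg0 i))); apply/subset_leq_card/fintype.subsetP => t.
case/neighboursP => l lik lt; rewrite inE.
have e1 := xchooseP (deg0 i); have e2 := xchooseP (deg0 k).
by case/set2P: lik lt => -> lt; rewrite ?eqik; apply/eqP; [rewrite -eqik|]; apply: (deg1 _ _ _ lt).
Qed.
End Hall.

Lemma union_bound (R : numDomainType) (X P : finType) (B : {set X})
    (D : pred P) (S : P -> {set X}) :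
  (forall x, x \in B -> exists2 p, D p & x \in S p) ->
  #|B|%:R <= \sum_(p | D p) #|S p|%:R :> R.
Proof.
move=> BS; rewrite -natr_sum ler_nat.
apply: (@leq_trans #|\bigcup_(p | D p) S p|).
  apply/subset_leq_card/fintype.subsetP => x /BS[p Dp Sp].
  by apply/bigcupP; exists p.
elim/big_ind2: _ => [|a A b B' hA hB|//]; first by rewrite cards0.
by apply: leq_trans (leq_of_leqif (leq_card_setU A B')) _; apply: leq_add.
Qed.

Lemma ltn_card_setC (n m : nat) (I : {set 'I_n}) :
  (#|~: I| < m)%N = (n < #|I| + m)%N.
Proof. by have := cardsC I; rewrite card_ord; lia. Qed.

(** * Short subfamilies that determine an intersection or a sum of subspaces *)

Section Subspaces.
Variables (F : fieldType) (V : vectType F) (I : finType).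

(** Greedy choice: while the partial intersection is too large, some member cuts it strictly, and
    [d] strict cuts would exceed the available codimension. Once the intersection is reached, copies
    of [j0] pad the tuple to length [d]. *)
Lemma bigcapv_tuple (W : I -> {vspace V}) (J : {set I}) (d : nat) :
  (0 < #|J|)%N -> (\dim {:V} < \dim (\bigcap_(j in J) W j)%VS + d)%N ->
  exists2 s : d.-tuple I, {subset s <= J} &
    (\bigcap_(a < d) W (tnth s a) = \bigcap_(j in J) W j)%VS.
Proof.
move=> /card_gt0P[j0 j0J] dimJ.
have [s sJ [eqs|le_s]] : exists2 s : d.-tuple I, {subset s <= J} &
    (\big[@capv _ V/fullv]_(j <- s) W j = \bigcap_(j in J) W j)%VS \/
    (\dim (\big[@capv _ V/fullv]_(j <- s) W j) + d <= \dim {:V})%N.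
- elim: d {dimJ} => [|d [s sJ IH]].
    by exists [tuple] => //; right; rewrite addn0 dimvS ?subvf.
  have sub_s : (\bigcap_(j in J) W j <= \big[@capv _ V/fullv]_(j <- s) W j)%VS.
    rewrite big_tuple; apply/subv_bigcapP => a _; apply: bigcapv_inf (subvv _).
    exact/sJ/mem_tnth.
  have cons_sub j : j \in J -> {subset [tuple of j :: s] <= J}.
    by move=> jJ k; rewrite inE => /predU1P[->//|/sJ].
  have [sub_J|nsub] := boolP (\big[@capv _ V/fullv]_(j <- s) W j
                                <= \bigcap_(j in J) W j)%VS.
    exists [tuple of j0 :: s]; first exact: cons_sub.
    left; rewrite big_cons; apply/eqP; rewrite eqEsubv subv_cap sub_s andbT.
    by rewrite (subv_trans (capvSr _ _)) //= (bigcapv_inf j0) ?subvv.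
  have [j jJ nj] : exists2 j, j \in J &
      ~~ (\big[@capv _ V/fullv]_(j <- s) W j <= W j)%VS.
    apply/exists_inP; apply: contraR nsub; rewrite negb_exists_in => /forall_inP h.
    by apply/subv_bigcapP => j /h; rewrite negbK.
  exists [tuple of j :: s]; first exact: cons_sub.
  right; case: IH => [eqs|le_s].
    by case/negP: nsub; rewrite eqs subvv.
  rewrite big_cons addnS; apply: leq_trans le_s; rewrite ltn_add2r.
  have le := dimv_leqif_sup (capvSr (W j) (\big[@capv _ V/fullv]_(j <- s) W j)%VS).
  rewrite (ltn_leqif le); apply: contra nj => h; apply: subv_trans h (capvSl _ _).
- by exists s => //; rewrite -eqs big_tuple.
- exists s => //; have : (\bigcap_(j in J) W j <= \big[@capv _ V/fullv]_(j <- s) W j)%VS.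
    rewrite big_tuple; apply/subv_bigcapP => a _; apply: bigcapv_inf (subvv _).
    exact/sJ/mem_tnth.
  by move=> /dimvS; lia.
Qed.

(** The dual greedy argument: each new vector raises the dimension above that of [E], which leaves
    room for fewer than [d] steps. *)
Lemma sumv_tuple (X : I -> V) (J : {set I}) (E : {vspace V}) (d : nat) :
  (0 < #|J|)%N -> (\dim {:V} < \dim E + d)%N ->
  exists2 s : d.-tuple I, {subset s <= J} &
    (E + \sum_(a < d) <[X (tnth s a)]> = E + \sum_(i in J) <[X i]>)%VS.
Proof.
move=> /card_gt0P[j0 j0J] dimE.
have [s sJ [eqs|le_s]] : exists2 s : d.-tuple I, {subset s <= J} &
    (E + \sum_(j <- s) <[X j]> = E + \sum_(i in J) <[X i]>)%VS \/
    (\dim E + d <= \dim (E + \sum_(j <- s) <[X j]>)%VS)%N.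
- elim: d {dimE} => [|d [s sJ IH]].
    by exists [tuple] => //; right; rewrite addn0 dimvS ?addvSl.
  have sub_s : (E + \sum_(j <- s) <[X j]> <= E + \sum_(i in J) <[X i]>)%VS.
    apply: addvS; first exact: subvv.
    rewrite big_tuple; apply/subv_sumP => a _; apply: sumv_sup (subvv _).
    exact/sJ/mem_tnth.
  have cons_sub j : j \in J -> {subset [tuple of j :: s] <= J}.
    by move=> jJ k; rewrite inE => /predU1P[->//|/sJ].
  have consE j : (E + \sum_(j <- j :: s) <[X j]> =
                  <[X j]> + (E + \sum_(j <- s) <[X j]>))%VS.
    by rewrite big_cons addvA [(E + _)%VS]addvC -addvA.
  have [sub_J|nsub] := boolP (E + \sum_(i in J) <[X i]>
                                <= E + \sum_(j <- s) <[X j]>)%VS.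
    exists [tuple of j0 :: s]; first exact: cons_sub.
    left; rewrite consE; apply/eqP; rewrite eqEsubv subv_add sub_s andbT.
    rewrite (subv_trans sub_J (addvSr _ _)) andbT.
    by apply: subv_trans (addvSr _ _); rewrite (sumv_sup j0) ?subvv.
  have [j jJ nj] : exists2 j, j \in J &
      ~~ (<[X j]> <= E + \sum_(j <- s) <[X j]>)%VS.
    apply/exists_inP; apply: contraR nsub; rewrite negb_exists_in => /forall_inP h.
    rewrite subv_add addvSl; apply/subv_sumP => j /h; rewrite negbK //.
  exists [tuple of j :: s]; first exact: cons_sub.
  right; case: IH => [eqs|le_s].
    by case/negP: nsub; rewrite eqs subvv.
  rewrite consE addnS; apply: (leq_ltn_trans le_s).
  have le := dimv_leqif_sup (addvSr <[X j]> (E + \sum_(j <- s) <[X j]>)%VS).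
  by rewrite (ltn_leqif le); apply: contra nj; rewrite subv_add => /andP[].
- by exists s => //; rewrite -eqs big_tuple.
- by have := leq_trans dimE le_s; rewrite ltnNge dimvS ?subvf.
Qed.
End Subspaces.

(** * Random tuples from a dispersed set, and matchings that avoid given subspaces *)

Section RandomBases.
Variables (R : realFieldType) (F : fieldType) (V : vectType F).
Variables (T : finType) (u : T -> V) (n : nat) (c : R).
Hypothesis dimV : \dim {:V} = n.
Hypothesis T0 : (0 < #|T|)%N.
Hypotheses (c0 : 0 < c) (c1 : c < 1).
Hypothesis disp : forall U : {vspace V},
  #|[set t | u t \in U]|%:R <= c ^+ (n - \dim U) * #|T|%:R.

Lemma dimv_le (U : {vspace V}) : (\dim U <= n)%N.
Proof. by rewrite -dimV dimvS ?subvf. Qed.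

Lemma disp_codim (U : {vspace V}) k : (\dim U + k <= n)%N ->
  #|[set t | u t \in U]|%:R <= c ^+ k * #|T|%:R.
Proof.
move=> h; apply: le_trans (disp U) _; apply: ler_wpM2r; first exact: ler0n.
by rewrite ler_wiXn2l ?ltW //; lia.
Qed.

Lemma subspace_count (K : finType) (Fr : {set K}) (U : {vspace V}) k :
  (\dim U + k <= n)%N ->
  #|[set x : {ffun K -> T} | [forall i in Fr, u (x i) \in U]]|%:R
    <= (c ^+ k) ^+ #|Fr| * #|T|%:R ^+ #|K|.
Proof.
move=> hU; have := @prod_count R K T Fr xpredT (fun _ _ => [set t | u t \in U])
  (c ^+ k) T0 (exprn_ge0 _ (ltW c0)).
rewrite [X in _ -> _ -> _ -> _ <= _ * X](_ : _ = #|T|%:R ^+ #|K|); last first.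
  by rewrite -natrX -card_ffun; congr (_%:R); apply: eq_card => x; rewrite inE.
rewrite (_ : [set x | _ && _] =
  [set x : {ffun K -> T} | [forall i in Fr, u (x i) \in U]]).
  by apply => // k' x _ _; apply: disp_codim.
by apply/setP => x; rewrite !inE; apply: eq_forallb => i; rewrite inE.
Qed.

Definition has_matching (W : 'I_n -> {vspace V}) (x : {ffun 'I_n -> T}) :=
  [exists f : {ffun 'I_n -> 'I_n}, injectiveb f && [forall j, u (x (f j)) \notin W j]].

(** Hall's theorem for the graph joining column [j] to entry [i] when [u (x i)] avoids [W j]: the
    entries outside the neighbourhood of [J] are exactly those lying in every [W j] with [j] in
    [J]. *)
Lemma no_matchingP (W : 'I_n -> {vspace V}) x : ~~ has_matching W x ->
  exists J : {set 'I_n},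
    (n < #|J| + #|[set i | u (x i) \in (\bigcap_(j in J) W j)%VS]|)%N.
Proof.
move=> nm.
pose e : {set 'I_n * 'I_n} := [set p | u (x p.2) \notin W p.1].
have : ~~ hall_cond e.
  apply: contra nm => /hall_matching[f injf fe]; apply/existsP; exists (finfun f).
  apply/andP; split; first by apply/injectiveP => i j; rewrite !ffunE => /injf.
  by apply/forallP => j; have := fe j; rewrite inE ffunE.
rewrite negb_forall => /existsP[J]; rewrite -ltnNge => ltJ; exists J.
have := cardsC (neighbours e J); rewrite card_ord => hC.
suff -> : [set i | u (x i) \in (\bigcap_(j in J) W j)%VS] = ~: neighbours e J.
  by rewrite -{1}hC ltn_add2r.
apply/setP => i; rewrite !inE memvE; apply/subv_bigcapP/idP => [h|h j jJ].
  by apply/exists_inP => -[j jJ]; rewrite !inE memvE h.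
move: h; rewrite negb_exists_in => /forall_inP /(_ j jJ).
by rewrite !inE negbK memvE.
Qed.

Lemma no_matching_count (W : 'I_n -> {vspace V}) (g h : nat) (b : R) :
  (forall j, \dim (W j) < n)%N ->
  (forall J : {set 'I_n}, g <= #|J| -> \dim (\bigcap_(j in J) W j) + h.*2 <= n)%N ->
  0 < b -> b <= 1 ->
  #|[set x | ~~ has_matching W x]|%:R <=
    (((1 + c ^+ h) ^+ n - 1) * (1 + c ^+ h) ^+ n + n%:R * (b ^- g * (c + b) ^+ n))
    * #|T|%:R ^+ n.
Proof.
move=> Wlt Wspread b0 b1.
have c0' := ltW c0; have c1' := ltW c1; have b0' := ltW b0.
(* Hall violators J with |J| < g go into Bt and are counted through one column;
   the weight b ^- g * b ^+ #|~: I| >= 1 turns the sum over I into (c + b) ^+ n. *)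
pose S (U : {vspace V}) (I : {set 'I_n}) :=
  [set x : {ffun 'I_n -> T} | [forall i in I, u (x i) \in U]].
pose Bt := [set x | ~~ has_matching W x] :&:
  \bigcup_(j < n) \bigcup_(I : {set 'I_n} | (n < g + #|I|)%N) S (W j) I.
have hBt : #|Bt|%:R <= n%:R * (b ^- g * (c + b) ^+ n) * #|T|%:R ^+ n.
  apply: le_trans (@union_bound R _ _ _ [pred p : 'I_n * {set 'I_n} | (n < g + #|p.2|)%N]
    (fun p => S (W p.1) p.2) _) _.
    move=> x /setIP[_ /bigcupP[j _ /bigcupP[I hI xS]]].
    by exists (j, I).
  rewrite -(pair_big_dep xpredT (fun _ (I : {set 'I_n}) => n < g + #|I|)%N
     (fun j I => #|S (W j) I|%:R)) /=.
  apply: (@le_trans _ _ (\sum_(j < n) (b ^- g * (c + b) ^+ n) * #|T|%:R ^+ n)).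
    apply: ler_sum => j _.
    have := sum_sets_exp 'I_n c b; rewrite card_ord => <-.
    rewrite mulr_sumr mulr_suml [leRHS](bigID (fun I : {set 'I_n} => (n < g + #|I|)%N)) /=.
    rewrite ler_wpDr //.
      apply: sumr_ge0 => I _; do !apply: mulr_ge0; rewrite ?exprn_ge0 //.
      by rewrite invr_ge0 exprn_ge0.
    apply: ler_sum => I hI.
    have := @subspace_count _ I (W j) 1%N; rewrite addn1 card_ord expr1 => /(_ (Wlt j)) le.
    apply: le_trans le _; rewrite ler_wpM2r ?exprn_ge0 //.
    rewrite mulrCA -[leLHS]mulr1 ler_wpM2l ?exprn_ge0 //.
    rewrite mulrC ler_pdivlMr ?exprn_gt0 // mul1r ler_wiXn2l //.
    by apply: ltnW; rewrite ltn_card_setC addnC.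
  by rewrite sumr_const card_ord -[leLHS]mulr_natl mulrA.
pose Bs := [set x | ~~ has_matching W x] :\: Bt.
(* Large violators: the entries indexed by [I] lie in codimension [h.*2], which has probability at
   most [a ^+ #|I| * a ^+ #|I|]. One factor pays for choosing [I]; the other is at most
   [a ^+ #|~: J|], since [#|~: J| < #|I|], and pays for [J]. The subtracted 1 is the term of the
   empty [I], excluded because [#|J| <= n]. *)
have hBs : #|Bs|%:R <= ((1 + c ^+ h) ^+ n - 1) * (1 + c ^+ h) ^+ n * #|T|%:R ^+ n.
  set a := c ^+ h; have a0 : 0 <= a by rewrite exprn_ge0.
  have a1 : a <= 1 by rewrite exprn_ile1.
  apply: le_trans (@union_bound R _ _ _ [pred p : {set 'I_n} * {set 'I_n} |
      (p.1 != finset.set0) && [&& g <= #|p.2| & n < #|p.2| + #|p.1|]%N]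
    (fun p => S (\bigcap_(j in p.2) W j)%VS p.1) _) _.
    move=> x /setDP[]; rewrite inE => nm xBt; have [J hJ] := no_matchingP nm.
    set I := [set i | u (x i) \in (\bigcap_(j in J) W j)%VS] in hJ.
    have Jn : (#|J| <= n)%N by rewrite -[leqRHS]card_ord max_card.
    have In : (#|I| <= n)%N by rewrite -[leqRHS]card_ord max_card.
    have xI i : i \in I -> u (x i) \in (\bigcap_(j in J) W j)%VS by rewrite inE.
    have J0 : (0 < #|J|)%N.
      by rewrite -(ltn_add2r #|I|) add0n (leq_ltn_trans In).
    exists (I, J) => /=; last by rewrite inE; apply/forall_inP.
    rewrite -card_gt0 hJ andbT; apply/andP; split.
      by rewrite -(ltn_add2l #|J|) addn0 (leq_ltn_trans Jn).
    rewrite leqNgt; apply: contra xBt => Jg; rewrite !inE nm /=.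
    case/card_gt0P: J0 => j jJ; apply/bigcupP; exists j => //.
    apply/bigcupP; exists I.
      by apply: leq_trans hJ _; rewrite leq_add2r ltnW.
    rewrite inE; apply/forall_inP => i /xI; apply/subvP.
    exact: bigcapv_inf (subvv _).
  have E1 : \sum_(I : {set 'I_n}) a ^+ #|I| = (1 + a) ^+ n.
    have := sum_sets_exp 'I_n a 1; rewrite card_ord addrC => <-.
    by apply: eq_bigr => I _; rewrite expr1n mulr1.
  have E2 : \sum_(I : {set 'I_n}) a ^+ #|~: I| = (1 + a) ^+ n.
    have := sum_sets_exp 'I_n 1 a; rewrite card_ord => <-.
    by apply: eq_bigr => I _; rewrite expr1n mul1r.
  have E3 : \sum_(I : {set 'I_n} | I != finset.set0) a ^+ #|I| = (1 + a) ^+ n - 1.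
    by rewrite -E1 [X in _ = X - _](bigD1 finset.set0) //= cards0 expr0 [1 + _]addrC addrK.
  rewrite -E3 -E2 big_distrlr /= pair_big_dep /= mulr_suml.
  rewrite [leRHS](bigID (fun p : {set 'I_n} * {set 'I_n} =>
     [&& g <= #|p.2| & n < #|p.2| + #|p.1|]%N)) /=.
  rewrite [leRHS](_ : _ = \sum_(p : {set 'I_n} * {set 'I_n} | (p.1 != finset.set0)
       && [&& g <= #|p.2| & n < #|p.2| + #|p.1|]%N)
       a ^+ #|p.1| * a ^+ #|~: p.2| * #|T|%:R ^+ n +
    \sum_(p : {set 'I_n} * {set 'I_n} | (p.1 != finset.set0)
       && ~~ [&& g <= #|p.2| & n < #|p.2| + #|p.1|]%N)
       a ^+ #|p.1| * a ^+ #|~: p.2| * #|T|%:R ^+ n); last first.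
    by congr (_ + _); apply: eq_bigl => p; rewrite andbT.
  rewrite ler_wpDr //.
    by apply: sumr_ge0 => p _; do !apply: mulr_ge0; rewrite ?exprn_ge0.
  apply: ler_sum => -[I J] /= /and3P[_ Jg hIJ].
  have := @subspace_count _ I (\bigcap_(j in J) W j)%VS h.*2 (Wspread J Jg).
  rewrite card_ord => le; apply: le_trans le _.
  rewrite ler_wpM2r ?exprn_ge0 // -muln2 exprM expr2 exprMn ler_wpM2l ?exprn_ge0 //.
  by rewrite ler_wiXn2l //; apply: ltnW; rewrite ltn_card_setC.
rewrite mulrDl (le_trans _ (lerD hBs hBt)) // -natrD ler_nat addnC.
by rewrite -(cardsID Bt) leq_add2r subset_leq_card // finset.subsetIr.
Qed.

(** * Spans of initial segments, ordered bases and random rows *)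

Definition pspan (y : 'I_n -> T) (k : nat) : {vspace V} :=
  (\sum_(i < n | (i < k)%N) <[u (y i)]>)%VS.

Lemma eq_pspan (y z : 'I_n -> T) k :
  (forall i : 'I_n, (i < k)%N -> y i = z i) -> pspan y k = pspan z k.
Proof. by move=> e; apply: eq_bigr => i /e ->. Qed.

Lemma pspan0 y : pspan y 0 = 0%VS.
Proof. by rewrite /pspan big1. Qed.

Lemma pspanS y (k : 'I_n) : pspan y k.+1 = (<[u (y k)]> + pspan y k)%VS.
Proof.
rewrite /pspan (bigD1 k) //=; congr (_ + _)%VS; apply: eq_bigl => i.
by rewrite ltnS [RHS]ltn_neqAle andbC.
Qed.

Lemma dim_pspanS y (k : 'I_n) : u (y k) \notin pspan y k ->
  \dim (pspan y k) = k -> \dim (pspan y k.+1) = k.+1.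
Proof.
move=> nin dimk; apply/eqP; rewrite eqn_leq pspanS; apply/andP; split.
  apply: leq_trans (leq_of_leqif (dimv_add_leqif _ _)) _.
  by rewrite dimk dim_vline -add1n leq_add2r leq_b1.
rewrite -{1}dimk (ltn_leqif (dimv_leqif_sup (addvSr _ _))).
by rewrite subv_add subvv andbT -memvE.
Qed.

Lemma dim_pspan_le y k : (k <= n)%N -> (\dim (pspan y k) <= k)%N.
Proof.
elim: k => [|k IH] kn; first by rewrite pspan0 dimv0.
rewrite (pspanS y (Ordinal kn)) /=.
apply: leq_trans (leq_of_leqif (dimv_add_leqif _ _)) _.
by rewrite dim_vline -(add1n k) leq_add ?leq_b1 // IH // ltnW.
Qed.

Definition ordered_basis (x : {ffun 'I_n -> T}) := \dim (pspan x n) == n.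

(** Reveal the entries one at a time: given [k] independent entries, the next one falls in their
    span, of codimension [n - k], with probability at most [c ^+ (n - k)]. *)
Lemma ordered_basis_count :
  (\prod_(i < n) (1 - c ^+ (n - i))) * #|T|%:R ^+ n
    <= #|[set x | ordered_basis x]|%:R.
Proof.
have c0' := ltW c0; have c1' := ltW c1.
suff H k : (k <= n)%N -> (\prod_(i < k) (1 - c ^+ (n - i))) * #|T|%:R ^+ n
    <= #|[set x : {ffun 'I_n -> T} | \dim (pspan x k) == k]|%:R by exact: H.
elim: k => [|k IH] kn.
  rewrite big_ord0 mul1r -natrX ler_nat -{1}[n]card_ord -card_ffun.
  rewrite -cardsT subset_leq_card //; apply/fintype.subsetP => x _.
  by rewrite inE pspan0 dimv0.
pose ko := Ordinal kn.
set D := [set x : {ffun 'I_n -> T} | \dim (pspan x k) == k] in IH.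
have loc (x y : {ffun 'I_n -> T}) : (forall i, i \notin [set ko] -> x i = y i) ->
    pspan x k = pspan y k.
  move=> e; apply: eq_pspan => i ik; apply: e; rewrite inE -val_eqE /=.
  by rewrite neq_ltn ik.
set D' := [set x in D | [forall i in [set ko], x i \in [set t | u t \in pspan x k]]].
have le : #|D'|%:R <= c ^+ (n - k) * #|D|%:R.
  have := @prod_count R 'I_n T [set ko] (mem D)
    (fun _ x => [set t | u t \in pspan x k]) (c ^+ (n - k)) T0 (exprn_ge0 _ c0').
  rewrite cards1 expr1 (_ : [set x | mem D x] = D); last by apply/setP => x; rewrite inE.
  apply => [x y /loc e|x y /loc -> //|i x]; first by rewrite /= !inE e.
  by rewrite /= inE => /eqP dk _; apply: disp_codim; rewrite dk subnKC // ltnW.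
rewrite big_ord_recr /= mulrAC [_ * (1 - _)]mulrC.
apply: (@le_trans _ _ ((1 - c ^+ (n - k)) * #|D|%:R)).
  by rewrite ler_wpM2l ?subr_ge0 ?exprn_ile1 // IH // ltnW.
rewrite mulrBl mul1r lerBlDr; apply: le_trans (lerD (lexx _) le).
rewrite -natrD ler_nat addnC -(cardsID D') leq_add //.
  by rewrite subset_leq_card // finset.subsetIr.
apply/subset_leq_card/fintype.subsetP => x; rewrite !inE => /andP[nD' xk].
move: nD'; rewrite xk /= => /forall_inPn[i /set1P ->]; rewrite inE => nin.
by rewrite (dim_pspanS (k := ko)) //; apply/eqP.
Qed.

Definition basis_row := {x : {ffun 'I_n -> T} | ordered_basis x}.

Variable delta : R.
Hypothesis delta0 : 0 < delta.
Hypothesis delta_le : delta * #|T|%:R ^+ n <= #|[set x | ordered_basis x]|%:R.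

Lemma card_basis_row : #|{: basis_row}| = #|[set x | ordered_basis x]|.
Proof. by rewrite card_sig cardsE. Qed.

Lemma card_basis_row_gt0 : (0 < #|{: basis_row}|)%N.
Proof.
rewrite -(ltr_nat R) card_basis_row; apply: lt_le_trans delta_le.
by rewrite mulr_gt0 // exprn_gt0 // ltr0n.
Qed.

Definition entry (X : {ffun 'I_n -> basis_row}) (i j : 'I_n) : T := val (X i) j.

(** Conditioning a uniform tuple on being an ordered basis multiplies probabilities by at most
    [delta^-1]. The event may depend on the other rows, because row [k] is independent of them. *)
Lemma row_count (k : 'I_n) (P : {ffun 'I_n -> basis_row} -> pred {ffun 'I_n -> T})
    (beta : R) : 0 <= beta ->
  (forall X Y : {ffun 'I_n -> basis_row}, (forall i, i != k -> X i = Y i) -> P X =1 P Y) ->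
  (forall X, #|[set x | P X x]|%:R <= beta * #|T|%:R ^+ n) ->
  #|[set X | P X (val (X k))]|%:R <= beta / delta * #|{ffun 'I_n -> basis_row}|%:R.
Proof.
move=> beta0 loc leP.
have := @prod_count R 'I_n {: basis_row} [set k] xpredT
  (fun _ X => [set r : basis_row | P X (val r)]) (beta / delta) card_basis_row_gt0.
rewrite (divr_ge0 beta0 (ltW delta0)) cards1 expr1.
have -> : #|[set X : {ffun 'I_n -> basis_row} | true]| = #|{ffun 'I_n -> basis_row}|.
  by apply: eq_card => X; rewrite inE.
move=> le; apply: le_trans (le _ _ _ _) => //; first last.
- move=> _ X _ _; apply: (@le_trans _ _ #|[set x | P X x]|%:R).
    rewrite ler_nat -(card_imset _ val_inj) subset_leq_card //.
    by apply/fintype.subsetP => _ /imsetP[r + ->]; rewrite !inE.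
  apply: le_trans (leP X) _; rewrite -mulrA ler_wpM2l // ler_pdivlMl //.
  by rewrite card_basis_row.
- move=> X Y e _ _; apply/setP => r; rewrite !inE; apply: loc => i ik.
  by apply: e; rewrite inE.
rewrite ler_nat.
apply/subset_leq_card/fintype.subsetP => X; rewrite !inE => PX.
by apply/forall_inP => i /set1P ->; rewrite inE.
Qed.

(** * Rearranging the rows, and the three ways in which this can fail *)

Notation arrangement := {ffun 'I_n -> {ffun 'I_n -> 'I_n}}.
Variables N g h : nat.
Hypotheses (N0 : (0 < N)%N) (Nn : (N <= n)%N) (dg : (h.*2 < g)%N).

Definition column (X : {ffun 'I_n -> basis_row}) (s : arrangement) (j i : 'I_n) : T :=
  entry X i (s i j).

(* The first N rows are kept in their random order and only the later rows are
   rearranged, so that the first N entries of a column stay random. *)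
Definition arranged k (X : {ffun 'I_n -> basis_row}) (s : arrangement) :=
  [&& [forall i, injectiveb (s i)],
      [forall i : 'I_n, forall j, (i < N)%N ==> (s i j == j)]
    & [forall j, \dim (pspan (column X s j) k) == k]].

Definition spread k (X : {ffun 'I_n -> basis_row}) (s : arrangement) :=
  [forall J : {set 'I_n}, (g <= #|J|)%N ==>
     (\dim (\bigcap_(j in J) pspan (column X s j) k)%VS + h.*2 <= n)%N].

Lemma eq_column k (X Y : {ffun 'I_n -> basis_row}) s j :
  (forall i : 'I_n, (i < k)%N -> X i = Y i) ->
  pspan (column X s j) k = pspan (column Y s j) k.
Proof. by move=> e; apply: eq_pspan => i /e; rewrite /column /entry => ->. Qed.

Definition early_clash : {set {ffun 'I_n -> basis_row}} :=
  \bigcup_(k < n | (k < N)%N) \bigcup_(j < n)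
    [set X | u (entry X k j) \in pspan (fun i => entry X i j) k].

(** The arrangement in use depends on the random matrix, so the bad event ranges over all [s] at
    once. *)
Definition clustered : {set {ffun 'I_n -> basis_row}} :=
  [set X | [exists k : 'I_n, exists s : arrangement,
     [&& (N <= k)%N, arranged k X s & ~~ spread k X s]]].

(** The conditions on [s] read only the rows before [k], hence so does the picked [s], and row [k]
    remains random once [s] is known. *)
Definition unmatched (k : 'I_n) (X : {ffun 'I_n -> basis_row}) (x : {ffun 'I_n -> T}) :=
  if [pick s | arranged k X s && spread k X s] is Some s
  then ~~ has_matching (fun j => pspan (column X s j) k) x else false.

Lemma arranged_exists (X : {ffun 'I_n -> basis_row}) :
  X \notin early_clash -> X \notin clustered ->
  (forall k : 'I_n, ~~ unmatched k X (val (X k))) ->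
  exists s, arranged n X s.
Proof.
move=> nclash nclus nunm; suff H k : (k <= n)%N -> exists s, arranged k X s by exact: H.
elim: k => [|k IH] kn.
  exists [ffun=> [ffun j => j]]; apply/and3P; split.
  - by apply/forallP => i; apply/injectiveP => j l; rewrite !ffunE.
  - by do 2 apply/forallP => ?; rewrite !ffunE eqxx implybT.
  - by apply/forallP => j; rewrite pspan0 dimv0.
pose ko := Ordinal kn.
have [s as_] := IH (ltnW kn).
(* Below [N] the row is kept in its own order, and the absence of early clashes makes the next entry
   of every column independent of the previous ones. *)
have [kN|Nk] := ltnP k N.
  exists s; case/and3P: as_ => sinj sid sdim; apply/and3P; split => //.
  have sidP (i j : 'I_n) : (i < N)%N -> s i j = j.
    by move=> iN; apply/eqP/(implyP (forallP (forallP sid i) j)).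
  apply/forallP => j; apply/eqP/(dim_pspanS (k := ko)); last exact/eqP/(forallP sdim).
  rewrite /column /= sidP //; apply: contra nclash => hX.
  apply/bigcupP; exists ko => //; apply/bigcupP; exists j => //; rewrite inE.
  move: hX; rewrite (@eq_pspan _ (fun i => entry X i j)) // => i ik.
  by rewrite /column sidP // (ltn_trans ik).
have : spread k X s.
  apply: contraR nclus => ns; rewrite inE; apply/existsP; exists ko.
  by apply/existsP; exists s; rewrite Nk as_ ns.
move=> sp; have := nunm ko; rewrite /unmatched.
(* The arrangement from the induction only shows that a candidate exists; the construction continues
   with the picked one, to which [unmatched] refers. *)
case: pickP => [{sp as_}s /andP[as_ _]|/(_ s)]; last by rewrite as_ sp.
rewrite negbK => /existsP[f /andP[finj fP]].
case/and3P: as_ => sinj sid sdim.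
(* Only row [k] changes, and [N <= k], so the first [N] rows stay in place and the column spans
   before row [k] are untouched. *)
pose s' : arrangement := [ffun i => if i == ko then f else s i].
exists s'; apply/and3P; split.
- by apply/forallP => i; rewrite ffunE; case: ifP => // _; apply: (forallP sinj).
- apply/forallP => i; apply/forallP => j; apply/implyP => iN.
  rewrite ffunE; case: (i =P ko) => [ik|_]; last by apply/(implyP (forallP (forallP sid i) j)).
  by move: iN; rewrite ik ltnNge Nk.
- apply/forallP => j; have E : pspan (column X s' j) k = pspan (column X s j) k.
    apply: eq_pspan => i ik; rewrite /column ffunE; case: eqP => // eik.
    by move: ik; rewrite eik ltnn.
  apply/eqP/(dim_pspanS (k := ko)); rewrite /= E; last exact/eqP/(forallP sdim).
  by rewrite /column ffunE eqxx; apply: (forallP fP).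
Qed.

Lemma early_clash_count :
  #|early_clash|%:R <= (n * n)%:R * (c ^+ (n - N) / delta) * #|{ffun 'I_n -> basis_row}|%:R.
Proof.
have c0' := ltW c0; have c1' := ltW c1.
apply: le_trans (@union_bound R _ _ _ [pred p : 'I_n * 'I_n | (p.1 < N)%N]
  (fun p => [set X | u (entry X p.1 p.2) \in pspan (fun i => entry X i p.2) p.1]) _) _.
  move=> X /bigcupP[k kN /bigcupP[j _ hX]]; by exists (k, j).
apply: (@le_trans _ _ (\sum_(p : 'I_n * 'I_n | (p.1 < N)%N)
    c ^+ (n - N) / delta * #|{ffun 'I_n -> basis_row}|%:R)).
  apply: ler_sum => -[k j] /= kN.
  apply: (@row_count k (fun X x => u (x j) \in pspan (fun i => entry X i j) k)).
  - exact: exprn_ge0.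
  - move=> X Y e x.
    rewrite (@eq_pspan (fun i => entry X i j) (fun i => entry Y i j)) // => i ik.
    by rewrite /entry e // -val_eqE neq_ltn ik.
  move=> X; have := @subspace_count 'I_n [set j] (pspan (fun i => entry X i j) k) (n - N).
  rewrite cards1 expr1 card_ord => le; apply: le_trans (le _); last first.
    apply: leq_trans (leq_add (dim_pspan_le _ (ltnW (ltn_ord k))) (leqnn _)) _.
    by rewrite -[leqRHS](subnKC Nn) leq_add2r ltnW.
  rewrite ler_nat; apply/subset_leq_card/fintype.subsetP => x.
  by rewrite !inE => hx; apply/forall_inP => i /set1P ->.
rewrite sumr_const -[leLHS]mulr_natl mulrA ler_wpM2r ?ler0n //.
rewrite ler_wpM2r //; first by rewrite divr_ge0 ?exprn_ge0 // ltW.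
rewrite ler_nat.
by apply: leq_trans (max_card _) _; rewrite card_prod card_ord.
Qed.

(** Row [k] is tested against column spans of dimension [k < n] that are fixed by the earlier rows,
    so the matching estimate applies with the cost [delta^-1] of one row. *)
Lemma unmatched_count (k : 'I_n) (b : R) : 0 < b -> b <= 1 ->
  #|[set X | unmatched k X (val (X k))]|%:R <=
    (((1 + c ^+ h) ^+ n - 1) * (1 + c ^+ h) ^+ n + n%:R * (b ^- g * (c + b) ^+ n))
    / delta * #|{ffun 'I_n -> basis_row}|%:R.
Proof.
move=> b0 b1; set beta := (X in X / delta).
have beta0 : 0 <= beta.
  have c0' := ltW c0; have b0' := ltW b0.
  have a1 : 1 <= (1 + c ^+ h) ^+ n by rewrite exprn_ege1 // lerDl exprn_ge0.
  apply: addr_ge0; first by rewrite mulr_ge0 ?subr_ge0 // (le_trans ler01).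
  by do 2 rewrite mulr_ge0 ?invr_ge0 ?ler0n ?exprn_ge0 ?addr_ge0 //.
apply: row_count => //.
  move=> X Y e x; have e' (i : 'I_n) : (i < k)%N -> X i = Y i.
    by move=> ik; apply: e; rewrite -val_eqE neq_ltn ik.
  rewrite /unmatched (_ : [pick s | _] = [pick s | arranged k Y s && spread k Y s]).
    case: pickP => // s _; rewrite /has_matching; congr (~~ _).
    apply: eq_existsb => f; congr (_ && _); apply: eq_forallb => j.
    by rewrite (eq_column _ _ e').
  apply: eq_pick => s; rewrite /arranged /spread; congr (_ && _).
    by congr [&& _, _ & _]; apply: eq_forallb => j; rewrite (eq_column _ _ e').
  apply: eq_forallb => J; congr (_ ==> (\dim _ + _ <= _)%N).
  by apply: eq_bigr => j _; rewrite (eq_column _ _ e').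
move=> X; rewrite /unmatched; case: pickP => [s /andP[/and3P[_ _ sdim] sp]|_].
  apply: no_matching_count => // [j|J gJ].
    by rewrite (eqP (forallP sdim j)).
  exact: (implyP (forallP sp J)).
rewrite (_ : [set _ | _] = finset.set0) ?cards0 ?mulr_ge0 ?exprn_ge0 ?ler0n //.
Qed.

(** * Encoding clustered matrices *)

(* A clustered matrix is certified by a code (k, t, J, I): row i of t lists the
   entries of row i used by h.*2 of the columns, which already cut out the
   common intersection of more than g columns; J is the set of the remaining
   columns of the cluster, and I j gives h.*2 rows among the first N whose
   entries in column j span, modulo that intersection, all of its first N
   entries. *)
Notation tuples := {ffun 'I_n -> (h.*2).-tuple 'I_n}.
Notation code := ((('I_n * tuples) * ({set 'I_n} * tuples))%type).

Definition code_meet (Y : {ffun 'I_n * 'I_n -> T}) (k : nat) (t : tuples) :=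
  (\bigcap_(a < h.*2) pspan (fun i => Y (i, tnth (t i) a)) k)%VS.

Definition code_span (Y : {ffun 'I_n * 'I_n -> T}) k (t I : tuples) (j : 'I_n) :=
  (code_meet Y k t + \sum_(a < h.*2) <[u (Y (tnth (I j) a, j))]>)%VS.

(** The cells on which the code makes a prediction. For a valid code the predicting subspaces read
    none of them, so these cells are independent of the prediction. *)
Definition code_free (p : code) : {set 'I_n * 'I_n} :=
  [set q : 'I_n * 'I_n | [&& (q.1 < N)%N, q.2 \in p.2.1 & q.1 \notin p.2.2 q.2]].

Definition code_valid (p : code) :=
  (g - h.*2 <= #|p.2.1|)%N &&
  [forall i : 'I_n, (i < N)%N ==> [forall a, tnth (p.1.2 i) a \notin p.2.1]].

(** The empty value for a full span builds properness of the span into the event, so each free cell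
    always costs a factor [c]. *)
Definition code_allowed (p : code) (q : 'I_n * 'I_n) (Y : {ffun 'I_n * 'I_n -> T}) :
    {set T} :=
  let U := code_span Y p.1.1 p.1.2 p.2.2 q.2 in
  if U == fullv then finset.set0 else [set t | u t \in U].

Definition code_event (p : code) : {set {ffun 'I_n * 'I_n -> T}} :=
  [set Y : {ffun 'I_n * 'I_n -> T} | [forall q in code_free p, Y q \in code_allowed p q Y]].

(** Each column of the code's set loses at most the [h.*2] rows that its tuple lists, out of the
    first [N]. *)
Lemma card_code_free p : code_valid p ->
  ((g - h.*2) * (N - h.*2) <= #|code_free p|)%N.
Proof.
case/andP => hJ _; apply: leq_trans (leq_mul hJ (leqnn _)) _.
have -> : #|code_free p| =
    (\sum_(j in p.2.1) #|[set i : 'I_n | (i < N) && (i \notin p.2.2 j)]|)%N.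
  rewrite -sum1_card.
  rewrite (eq_bigl (fun q : 'I_n * 'I_n =>
     (q.2 \in p.2.1) && ((q.1 < N)%N && (q.1 \notin p.2.2 q.2)))); last first.
    by move=> q; rewrite inE andbCA.
  rewrite -(pair_big_dep xpredT (fun (i j : 'I_n) => (j \in p.2.1) && ((i < N)%N && (i \notin p.2.2 j)))
    (fun _ _ => 1%N)) /=.
  rewrite (exchange_big_dep (mem p.2.1)) /=; last by move=> i j _ /andP[].
  apply: eq_bigr => j jJ; rewrite -sum1_card; apply: eq_bigl => i.
  by rewrite !inE jJ.
rewrite -sum_nat_const; apply: leq_sum => j _.
pose D := [set i : 'I_n | (i < N)%N].
have cD : #|D| = N.
  rewrite -sum1_card (eq_bigl (fun i : 'I_n => (i < N)%N)) => [|i]; last by rewrite inE.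
  by rewrite (big_ord_narrow Nn) sum1_card card_ord.
have -> : [set i : 'I_n | (i < N)%N && (i \notin p.2.2 j)] =
    D :\: [set i in p.2.2 j] by apply/setP => i; rewrite !inE andbC.
have := cardsID [set i in p.2.2 j] D; rewrite cD => E.
have le : (#|D :&: [set i in p.2.2 j]| <= h.*2)%N.
  apply: leq_trans (subset_leq_card (finset.subsetIr _ _)) _.
  rewrite cardsE -[leqRHS](size_tuple (p.2.2 j)); exact: card_size.
by rewrite leq_subLR -{1}E leq_add2r.
Qed.

Lemma code_event_count p : code_valid p ->
  #|code_event p|%:R <=
    c ^+ ((g - h.*2) * (N - h.*2)) * #|T|%:R ^+ (n * n).
Proof.
move=> vp; have c0' := ltW c0; have c1' := ltW c1.
have cfree := card_code_free vp; case/andP: vp => _ /forallP vp.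
(* In rows below [N] validity keeps the listed columns outside the set [p.2.1], and later rows
   contain no free cell. *)
have meet_loc (X Y : {ffun 'I_n * 'I_n -> T}) :
    (forall q, q \notin code_free p -> X q = Y q) ->
    code_meet X p.1.1 p.1.2 = code_meet Y p.1.1 p.1.2.
  move=> e; apply: eq_bigr => a _; apply: eq_pspan => i _; apply: e.
  rewrite inE /=; apply/negP => /and3P[iN iJ _].
  by have /forallP/(_ a)/negP := implyP (vp i) iN.
have := @prod_count R ('I_n * 'I_n)%type T (code_free p) xpredT (code_allowed p) c T0 c0'.
have -> : #|[set Y : {ffun 'I_n * 'I_n -> T} | true]|%:R = #|T|%:R ^+ (n * n) :> R.
  have <- : #|{: 'I_n * 'I_n}| = (n * n)%N by rewrite card_prod card_ord.
  rewrite -natrX -card_ffun; congr (_%:R).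
  by apply: eq_card => Y; rewrite inE.
have -> : [set Y : {ffun 'I_n * 'I_n -> T} | xpredT Y & [forall q in code_free p, Y q \in code_allowed p q Y]]
   = code_event p by apply/setP => Y; rewrite !inE.
move=> le; apply: (le_trans (le _ _ _)) => //.
- move=> X Y e q; rewrite inE => /and3P[_ _ qI].
  rewrite /code_allowed /code_span (meet_loc X Y e).
  suff -> : (\sum_(a < h.*2) <[u (X (tnth (p.2.2 q.2) a, q.2))]> =
     \sum_(a < h.*2) <[u (Y (tnth (p.2.2 q.2) a, q.2))]>)%VS by [].
  by apply: eq_bigr => a _; rewrite e // inE /= mem_tnth !andbF.
- move=> q Y _ _; rewrite /code_allowed; case: ifPn => [_|nf].
    by rewrite cards0 mulr_ge0.
  rewrite -[c]expr1; apply: disp_codim; rewrite addn1.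
  rewrite ltn_neqAle dimv_le andbT.
  apply: contra nf => /eqP e; rewrite eqEdim subvf /=.
  by rewrite dimV e.
by rewrite ler_wpM2r ?exprn_ge0 // ler_wiXn2l.
Qed.

Definition entries (X : {ffun 'I_n -> basis_row}) : {ffun 'I_n * 'I_n -> T} :=
  [ffun q => entry X q.1 q.2].

Lemma entries_inj : injective entries.
Proof.
move=> X Y e; apply/ffunP => i; apply: val_inj; apply/ffunP => j.
by have := congr1 (fun Z : {ffun 'I_n * 'I_n -> T} => Z (i, j)) e; rewrite !ffunE.
Qed.

Lemma clustered_code X : X \in clustered ->
  exists2 p, code_valid p & entries X \in code_event p.
Proof.
rewrite inE => /existsP[k /existsP[s /and3P[Nk as_ nsp]]].
case/and3P: as_ => _ sid sdim.
have sidP (i j : 'I_n) : (i < N)%N -> s i j = j.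
  by move=> iN; apply/eqP/(implyP (forallP (forallP sid i) j)).
move: nsp; rewrite negb_forall => /existsP[J].
rewrite negb_imply -ltnNge => /andP[gJ ltJ].
set E := (\bigcap_(j in J) _)%VS in ltJ.
have J0 : (0 < #|J|)%N by apply: leq_trans gJ; apply: leq_ltn_trans dg.
have [w wJ wE] := bigcapv_tuple J0 (etrans (congr1 (fun m => m < _)%N dimV) ltJ).
pose t : tuples := [ffun i => map_tuple (s i) w].
(* Here [t] already incorporates [s], so the code recovers the intersection without storing the
   whole arrangement. *)
have meetE : code_meet (entries X) k t = E.
  rewrite /E -wE; apply: eq_bigr => a _; apply: eq_pspan => i _.
  by rewrite !ffunE tnth_map.
pose D := [set i : 'I_n | (i < N)%N].
have D0 : (0 < #|D|)%N.
  by apply/card_gt0P; exists (Ordinal (leq_trans N0 Nn)); rewrite inE.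
have /fin_all_exists[I IP] (j : 'I_n) : exists I : (h.*2).-tuple 'I_n,
    (E + \sum_(a < h.*2) <[u (entry X (tnth I a) j)]> =
     E + \sum_(i in D) <[u (entry X i j)]>)%VS.
  have [I _ IE] := sumv_tuple (fun i => u (entry X i j)) D0
    (etrans (congr1 (fun m => m < _)%N dimV) ltJ).
  by exists I.
pose J1 := J :\: [set j in w].
exists ((k, t), (J1, finfun I)).
  apply/andP; split => /=.
    rewrite leq_subLR; apply: leq_trans gJ _.
    rewrite -(cardsID [set j in w] J) leq_add2r.
    apply: leq_trans (subset_leq_card (finset.subsetIr _ _)) _.
    rewrite cardsE -[leqRHS](size_tuple w); exact: card_size.
  apply/forallP => i; apply/implyP => iN; apply/forallP => a.
  by rewrite ffunE tnth_map sidP // !inE mem_tnth.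
rewrite inE; apply/forall_inP => -[i j]; rewrite inE /= => /and3P[iN jJ1 _].
have jJ : j \in J by move: jJ1; rewrite inE => /andP[].
have spanE : code_span (entries X) k t (finfun I) j =
    (E + \sum_(i in D) <[u (entry X i j)]>)%VS.
  rewrite /code_span meetE -IP; congr (_ + _)%VS; apply: eq_bigr => a _.
  by rewrite !ffunE.
rewrite /code_allowed /= spanE ifN; last first.
  (* The arranged span of column [j] contains [E], as [j] is in [J], and its first [N] entries, as
     [N <= k] and those rows are not permuted. It has dimension [k < n], so the coded span is
     proper. *)
  apply/negP => /eqP full.
  have : (fullv <= pspan (column X s j) k)%VS.
    rewrite -full subv_add (bigcapv_inf j) ?subvv //=.
    apply/subv_sumP => l; rewrite inE => lN.
    by rewrite (sumv_sup l) ?(leq_trans lN) // /column sidP ?subvv.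
  move/dimvS; rewrite dimV (eqP (forallP sdim j)).
  by rewrite leqNgt ltn_ord.
rewrite inE ffunE /=; apply: (subvP (addvSr _ _)).
by rewrite memvE (sumv_sup i) ?inE ?subvv.
Qed.

(** Union bound over the codes. Through [entries] the matrix is counted among all matrices over [T],
    which costs [delta^-1] for each of the [n] rows. *)
Lemma clustered_count :
  #|clustered|%:R <= ((n * (n ^ h.*2) ^ n) * (2 ^ n * (n ^ h.*2) ^ n))%N%:R *
    (c ^+ ((g - h.*2) * (N - h.*2)) / delta ^+ n) * #|{ffun 'I_n -> basis_row}|%:R.
Proof.
have c0' := ltW c0.
rewrite -(card_imset _ entries_inj).
apply: le_trans (@union_bound R _ _ _ code_valid code_event _) _.
  by move=> _ /imsetP[X /clustered_code[p vp Xp] ->]; exists p.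
set q := c ^+ _.
have q0 : 0 <= q / delta ^+ n * #|{ffun 'I_n -> basis_row}|%:R.
  by rewrite !mulr_ge0 ?invr_ge0 ?exprn_ge0 ?ler0n // ltW.
apply: (@le_trans _ _ (\sum_(p | code_valid p) q / delta ^+ n * #|{ffun 'I_n -> basis_row}|%:R)).
  apply: ler_sum => p vp; apply: le_trans (code_event_count vp) _.
  rewrite -mulrA ler_wpM2l ?exprn_ge0 // ler_pdivlMl ?exprn_gt0 //.
  rewrite card_ffun card_ord natrX exprM -exprMn lerXn2r ?nnegrE ?ler0n //.
    by rewrite mulr_ge0 ?exprn_ge0 // ltW.
  by rewrite card_basis_row.
rewrite sumr_const -[leLHS]mulr_natl -[leRHS]mulrA ler_wpM2r // ler_nat.
apply: leq_trans (max_card _) _.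
have cs : #|{set 'I_n}| = (2 ^ n)%N.
  by rewrite -cardsT -powersetT card_powerset cardsT card_ord.
by rewrite !card_prod cs !card_ffun !card_tuple card_ord.
Qed.

Lemma unarranged_count (b : R) : 0 < b -> b <= 1 ->
  #|[set X | ~~ [exists s, arranged n X s]]|%:R <=
   ((n * n)%:R * (c ^+ (n - N) / delta) +
    ((n * (n ^ h.*2) ^ n) * (2 ^ n * (n ^ h.*2) ^ n))%N%:R *
      (c ^+ ((g - h.*2) * (N - h.*2)) / delta ^+ n) +
    n%:R * ((((1 + c ^+ h) ^+ n - 1) * (1 + c ^+ h) ^+ n
            + n%:R * (b ^- g * (c + b) ^+ n)) / delta))
   * #|{ffun 'I_n -> basis_row}|%:R.
Proof.
move=> b0 b1; set beta := (X in _ + _ * (X / delta)).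
pose M := \bigcup_(k < n) [set X | unmatched k X (val (X k))].
have hM : #|M|%:R <= n%:R * (beta / delta) * #|{ffun 'I_n -> basis_row}|%:R.
  apply: le_trans (@union_bound R _ _ _ xpredT
    (fun k => [set X | unmatched k X (val (X k))]) _) _.
    by move=> X /bigcupP[k _ Xk]; exists k.
  apply: le_trans (ler_sum _ (fun k _ => unmatched_count k b0 b1)) _.
  by rewrite -/beta sumr_const card_ord -[leRHS]mulrA mulr_natl.
rewrite 2!mulrDl; apply: le_trans (lerD (lerD early_clash_count clustered_count) hM).
rewrite -!natrD ler_nat.
apply: leq_trans (_ : #|(early_clash :|: clustered) :|: M| <= _)%N.
  apply/subset_leq_card/fintype.subsetP => X; rewrite 4!inE => nX.
  apply: contraR nX; rewrite !negb_or => /andP[/andP[n1 n2] n3].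
  apply/existsP; apply: arranged_exists; rewrite ?n1 ?inE //.
  move=> k; apply: contra n3 => hk; apply/bigcupP; exists k => //.
  by rewrite inE.
apply: leq_trans (leq_of_leqif (leq_card_setU _ _)) _; rewrite leq_add2r.
exact: leq_of_leqif (leq_card_setU _ _).
Qed.

End RandomBases.

(** * Numerical estimates and the choice of parameters *)

Section Estimates.
Variable R : archiRealFieldType.

Lemma exprn_bernoulli (x : R) k : 0 <= x -> x <= 1 ->
  x ^+ k * (1 + k%:R * (1 - x)) <= 1.
Proof.
move=> x0 x1; elim: k => [|k IH]; first by rewrite expr0 mul0r addr0 mulr1.
apply: le_trans IH; rewrite exprSr -mulrA ler_wpM2l ?exprn_ge0 //.
have : 0 <= (k%:R + 1) * (1 - x) ^+ 2 by rewrite mulr_ge0 ?addr_ge0 ?sqr_ge0.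
by rewrite -natr1; lra.
Qed.

Lemma exprn_small (x eps : R) : 0 <= x -> x < 1 -> 0 < eps ->
  exists2 k, (0 < k)%N & x ^+ k <= eps.
Proof.
move=> x0 x1 e0; have t0 : 0 < 1 - x by rewrite subr_gt0.
(* Any [k] above [z] makes [k%:R * (1 - x)] exceed [eps^-1], and Bernoulli's inequality
   concludes. *)
pose z := eps^-1 / (1 - x).
have z0 : 0 <= z by rewrite divr_ge0 ?invr_ge0 ?(ltW e0) ?(ltW t0).
have := archi_boundP z0; set k := Num.bound z => hk.
have k0 : (0 < k)%N by rewrite -(ltr_nat R); apply: le_lt_trans hk.
exists k => //; have := exprn_bernoulli k x0 (ltW x1).
move: hk; rewrite /z ltr_pdivrMr // => hk le.
rewrite -[eps]invrK -[_^-1]mul1r ler_pdivlMr ?invr_gt0 //.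
apply: le_trans le; rewrite ler_wpM2l ?exprn_ge0 // (le_trans (ltW hk)) //.
by rewrite lerDr ler01.
Qed.

Lemma prod_1mexp_ge (c : R) : 0 < c -> c < 1 ->
  exists2 delta : R, 0 < delta &
    forall n, delta <= \prod_(i < n) (1 - c ^+ (n - i)).
Proof.
move=> c0 c1; have c0' := ltW c0; have c1' := ltW c1.
have [|q _ hq] := exprn_small c0' c1 (eps := (1 - c) / 2).
  by rewrite divr_gt0 // subr_gt0.
pose p m := \prod_(k < m) (1 - c ^+ k.+1).
have f01 k : 0 < 1 - c ^+ k.+1 <= 1.
  by rewrite subr_gt0 exprn_ilt1 //= gerBl exprn_ge0.
have p0 m : 0 < p m by apply: prodr_gt0 => k _; case/andP: (f01 k).
(* The bound [p q / 2] alone is not inductive. The term [c ^+ m] adds a slack whose decrease,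
   [(1 - c) / 2 * c ^+ m], absorbs the loss from the next factor by the choice of [q]. *)
have step m : p q * ((1 + c ^+ m) / 2) <= p (q + m)%N.
  elim: m => [|m IH].
    by rewrite addn0 expr0 -[(1 + 1)]/(2%:R) divff ?pnatr_eq0 // mulr1.
  rewrite addnS /p big_ord_recr /= -/(p (q + m)%N).
  apply: le_trans (_ : p q * ((1 + c ^+ m) / 2) * (1 - c ^+ (q + m).+1) <= _); last first.
    by rewrite ler_wpM2r //; case/andP: (f01 (q + m)%N) => /ltW.
  rewrite -mulrA ler_wpM2l ?(ltW (p0 _)) //.
  rewrite [c ^+ (q + m).+1]exprS [c ^+ m.+1]exprS exprD.
  have m0 : 0 <= c ^+ m by rewrite exprn_ge0.
  have m1 : c ^+ m <= 1 by rewrite exprn_ile1.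
  have q0 : 0 <= c ^+ q by rewrite exprn_ge0.
  set a := c ^+ m in m0 m1 *; set b := c ^+ q in hq q0 *.
  have h1 : c * (b * a) * ((1 + a) / 2) <= (1 - c) / 2 * a.
    apply: le_trans (_ : b * a <= _); last by rewrite ler_wpM2r.
    rewrite -mulrA mulrCA -[leRHS]mulr1 ler_wpM2l // -?mulrA ?mulr_ge0 //.
    by nra.
  nra.
exists (p q / 2) => [|n]; first by rewrite divr_gt0.
have -> : \prod_(i < n) (1 - c ^+ (n - i)) = p n.
  rewrite (reindex_inj rev_ord_inj); apply: eq_bigr => i _ /=.
  by rewrite subKn.
have [qn|nq] := leqP q n.
  apply: le_trans (_ : p q * ((1 + c ^+ (n - q)) / 2) <= _).
    have m0 : 0 <= c ^+ (n - q) by rewrite exprn_ge0.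
    by rewrite ler_wpM2l ?(ltW (p0 _)) //; lra.
  by rewrite -{2}(subnKC qn).
apply: le_trans (_ : p q <= _).
  by rewrite ler_pdivrMr // ler_peMr ?(ltW (p0 _)) // ler1n.
rewrite -(subnKC (ltnW nq)) /p big_split_ord /= ler_piMr ?(ltW (p0 _)) //.
by apply: prodr_ile1 => i; case/andP: (f01 (n + i)%N) => /ltW -> ->.
Qed.

Local Notation y := (2^-1 : R).

(** With the next two lemmas this reduces all estimates to bookkeeping of exponents of 1/2:
    exponents of [x] are worth a [K]-th part, integer factors cost their binary logarithm, and
    division by [d] costs [K]. *)
Lemma exprn_le_half (x : R) K q m : 0 <= x -> x <= 1 -> x ^+ K <= y ->
  (K * q <= m)%N -> x ^+ m <= y ^+ q.
Proof.
move=> x0 x1 xK Km; apply: le_trans (_ : x ^+ (K * q) <= _).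
  by rewrite ler_wiXn2l.
by rewrite exprM lerXn2r ?nnegrE ?exprn_ge0 // invr_ge0.
Qed.

Lemma natr_mul_le (A al be : nat) (x : R) : (A <= 2 ^ al)%N ->
  x <= y ^+ (al + be) -> A%:R * x <= y ^+ be.
Proof.
move=> A2 xle; apply: le_trans (ler_wpM2l (ler0n _ _) xle) _.
rewrite exprD mulrA ler_piMl ?exprn_ge0 ?invr_ge0 //.
by rewrite exprVn ler_pdivrMr ?exprn_gt0 // mul1r -natrX ler_nat.
Qed.

Lemma div_le_half (d x : R) K be : 0 < d -> y ^+ K <= d ->
  x <= y ^+ (K + be) -> x / d <= y ^+ be.
Proof.
move=> d0 dK xle; rewrite ler_pdivrMr //; apply: le_trans xle _.
by rewrite exprD mulrC ler_wpM2l ?exprn_ge0 ?invr_ge0.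
Qed.

Lemma exp1D_le (a : R) n : 0 <= a -> n%:R * a <= y ->
  (1 + a) ^+ n <= 1 + 2 * (n%:R * a).
Proof.
move=> a0; elim: n => [|n IH] na; first by rewrite expr0 mul0r mulr0 addr0.
have na' : n%:R * a <= y by apply: le_trans na; rewrite ler_wpM2r // ler_nat.
rewrite exprS; apply: le_trans (ler_wpM2l _ (IH na')) _; first by rewrite addr_ge0.
rewrite -[n.+1%:R]natr1; set z := n%:R * a in na' *.
have : a * z <= a * y by rewrite ler_wpM2l.
have -> : (n%:R + 1) * a = z + a by rewrite mulrDl mul1r.
by lra.
Qed.

Lemma fifth_root n : exists s, (s ^ 5 <= n < s.+1 ^ 5)%N.
Proof.
elim: n => [|n [s /andP[h1 h2]]]; first by exists 0%N.
have [h|h] := leqP (s.+1 ^ 5) n.+1; last by exists s; rewrite h (leq_trans h1).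
exists s.+1; rewrite h /=; apply: leq_ltn_trans h2 _.
by rewrite ltn_exp2r.
Qed.

(** The exponent budgets, in order, for early clashes, for codes, for large Hall violators and for
    small ones. In the proof products and powers are generalized to variables, which leaves linear
    goals. *)
Lemma scale_bounds (K s n : nat) : (0 < K)%N -> (256 * K ^ 2 <= s)%N -> (s ^ 5 <= n)%N ->
  [/\ K * (K + 17 * s) <= n - n./2,
      K * (K * n + (5 * s + 20 * s ^ 3 * n + n + 7 * s)) <=
        (s ^ 4 - 2 * s ^ 2) * (n./2 - 2 * s ^ 2),
      K * (17 * s + K + 3) <= s ^ 2
    & K * (K * s ^ 4 + (17 * s + K + 1)) <= n]%N.
Proof.
move=> K0 Ks sn.
have K1 : (K <= K ^ 2)%N by rewrite -[leqLHS]expn1 leq_pexp2l.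
have Ks1 : (256 * K <= s)%N by apply: leq_trans Ks; rewrite leq_mul2l K1 orbT.
have s0 : (256 <= s)%N by apply: leq_trans Ks1; rewrite leq_pmulr.
have q2 : (256 * K * s <= s ^ 2)%N by rewrite (expnS s 1) expn1 leq_mul2r Ks1 orbT.
have s2 : (256 * s <= s ^ 2)%N by rewrite (expnS s 1) expn1 leq_mul2r s0 orbT.
have s3 : (256 * s ^ 2 <= s ^ 3)%N by rewrite (expnS s 2) leq_mul2r s0 orbT.
have s4 : (256 * s ^ 3 <= s ^ 4)%N by rewrite (expnS s 3) leq_mul2r s0 orbT.
have s5 : (256 * s ^ 4 <= s ^ 5)%N by rewrite (expnS s 4) leq_mul2r s0 orbT.
have k4 : (256 * K * s ^ 3 <= s ^ 4)%N by rewrite (expnS s 3) leq_mul2r Ks1 orbT.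
have k5 : (256 * K ^ 2 * s ^ 4 <= s ^ 5)%N by rewrite (expnS s 4) leq_mul2r Ks orbT.
have KK : (K * K <= K * s)%N.
  by rewrite leq_mul2l (leq_trans _ Ks1) ?orbT // leq_pmull.
have K3 : (3 * K <= K * s)%N by rewrite mulnC leq_mul2l (leq_trans _ s0) ?orbT.
have [hn1 hn2] : (n <= 2 * (n - n./2))%N /\ (n <= 2 * n./2 + 1)%N.
  have := odd_double_half n; have := leq_b1 (odd n); lia.
have eK : (K * (17 * s + K + 3) = 17 * (K * s) + K * K + 3 * K)%N
  by rewrite 2!mulnDr (mulnCA K 17) (mulnC K 3).
have eK2 : (256 * K * s = 256 * (K * s))%N by rewrite mulnA.
have i3 : (K * (17 * s + K + 3) <= s ^ 2)%N by lia.
split => //.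
- have le : (K * (K + 17 * s) <= K * (17 * s + K + 3))%N by rewrite leq_mul2l; lia.
  move: (s ^ 2)%N (s ^ 3)%N (s ^ 4)%N (s ^ 5)%N (K * _)%N (K * _)%N le i3 s3 s4 s5 sn hn1 => *; lia.
- set m := (n./2)%N in hn2 *.
  have h1 : (s ^ 4 <= 2 * (s ^ 4 - 2 * s ^ 2))%N.
    move: (s ^ 2)%N (s ^ 3)%N (s ^ 4)%N s3 s4 => *; lia.
  have h2 : (n <= 4 * (m - 2 * s ^ 2))%N.
    move: (s ^ 2)%N (s ^ 3)%N (s ^ 4)%N (s ^ 5)%N s2 s3 s4 s5 sn => *; lia.
  have h3 := leq_mul h1 h2.
  have e3 : (2 * (s ^ 4 - 2 * s ^ 2) * (4 * (m - 2 * s ^ 2)) =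
    8 * ((s ^ 4 - 2 * s ^ 2) * (m - 2 * s ^ 2)))%N by rewrite mulnACA.
  have l1 : (K * n <= s ^ 3 * n)%N.
    rewrite leq_mul2r; apply/orP; right.
    move: (s ^ 2)%N (s ^ 3)%N s2 s3 => *; lia.
  have l2 : (2 * n <= s ^ 3 * n)%N.
    rewrite leq_mul2r; apply/orP; right.
    move: (s ^ 2)%N (s ^ 3)%N s2 s3 => *; lia.
  have l3 : (12 * s <= n)%N.
    move: (s ^ 2)%N (s ^ 3)%N (s ^ 4)%N (s ^ 5)%N s2 s3 s4 s5 sn => *; lia.
  have h4 : (K * n + (5 * s + 20 * s ^ 3 * n + n + 7 * s) <= 23 * (s ^ 3 * n))%N.
    rewrite -(mulnA 20); move: (s ^ 3 * n)%N (K * n)%N l1 l2 => *; lia.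
  have h5 : (256 * K * s ^ 3 * n <= s ^ 4 * n)%N by rewrite leq_mul2r k4 orbT.
  have h6 := leq_mul (leqnn K) h4.
  have e : (K * (23 * (s ^ 3 * n)) = 23 * (K * (s ^ 3 * n)))%N by rewrite mulnCA.
  have e' : (256 * K * s ^ 3 * n = 256 * (K * (s ^ 3 * n)))%N by rewrite !mulnA.
  move: h3 h5 h6; rewrite e e' e3.
  move: (K * _)%N ((_ - _) * _)%N (s ^ 4 * n)%N (K * _)%N => *; lia.
- have e : (K * (K * s ^ 4) = K ^ 2 * s ^ 4)%N by rewrite mulnA mulnn.
  have le : (K * (17 * s + K + 1) <= K * (17 * s + K + 3))%N by rewrite leq_mul2l; lia.
  rewrite mulnDr e; move: k5; rewrite -mulnA.
  move: (K ^ 2 * s ^ 4)%N (s ^ 2)%N (s ^ 3)%N (s ^ 4)%N (s ^ 5)%N (K * _)%N (K * _)%N le i3 s3 s4 s5 sn => *; lia.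
Qed.

Lemma failure_bound (c delta : R) : 0 < c -> c < 1 -> 0 < delta ->
  exists n0, forall n, (n0 <= n)%N -> exists N, exists g, exists h, exists b : R,
    [/\ [/\ 0 < N, N <= n & h.*2 < g]%N, 0 < b, b <= 1 &
   (n * n)%:R * (c ^+ (n - N) / delta) +
    ((n * (n ^ h.*2) ^ n) * (2 ^ n * (n ^ h.*2) ^ n))%N%:R *
      (c ^+ ((g - h.*2) * (N - h.*2)) / delta ^+ n) +
    n%:R * ((((1 + c ^+ h) ^+ n - 1) * (1 + c ^+ h) ^+ n
            + n%:R * (b ^- g * (c + b) ^+ n)) / delta) <= n.+1%:R^-1].
Proof.
move=> c0 c1 d0; have c0' := ltW c0; have c1' := ltW c1.
have [b [b0 b1 cb1]] : exists b : R, [/\ 0 < b, b <= 1 & c + b < 1].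
  (* Halfway between 0 and [1 - c]: then [(c + b) ^+ n] decays exponentially and outweighs [b ^- g],
     where [g = s ^ 4] is much smaller than [n]. *)
  by exists ((1 - c) / 2); split; lra.
have cb0 : 0 <= c + b by rewrite addr_ge0 // ltW.
have y0 : 0 < y by rewrite invr_gt0.
have y1 : y < 1 by rewrite invf_lt1 // ltr1n.
have y0' := ltW y0; have y1' := ltW y1.
have [K1 _ hK1] := exprn_small cb0 cb1 y0.
have [K2 _ hK2] := exprn_small y0' y1 d0.
have [K3 _ hK3] := exprn_small y0' y1 b0.
have [K [K0 KK1 KK2 KK3]] : exists K, [/\ 0 < K, K1 <= K, K2 <= K & K3 <= K]%N.
  exists (K1 + K2 + K3).+1; split => //; apply: leqW; last exact: leq_addl.
    by rewrite -addnA leq_addr.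
  by rewrite addnAC leq_addl.
have cbK : (c + b) ^+ K <= y.
  by apply: le_trans hK1; apply: ler_wiXn2l => //; apply: ltW.
have cK : c ^+ K <= y.
  by apply: le_trans cbK; rewrite lerXn2r ?nnegrE // lerDl ltW.
have dK : y ^+ K <= delta by apply: le_trans hK2; apply: ler_wiXn2l.
have bK : y ^+ K <= b by apply: le_trans hK3; apply: ler_wiXn2l.
(* A fifth power, so that the integer fifth root [s] of [n] is at least [256 * K ^ 2]. *)
exists (((256 * K ^ 2).+1) ^ 5)%N => n hn.
have [s /andP[sn ns]] := fifth_root n.
have Ks : (256 * K ^ 2 <= s)%N by have := leq_ltn_trans hn ns; rewrite ltn_exp2r // => /ltnW.
have [B1 B2 B3 B4] := scale_bounds K0 Ks sn.
have s0 : (256 <= s)%N.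
  by apply: leq_trans Ks; rewrite leq_pmulr // expn_gt0 K0.
have n1 : (n.+1 <= 2 ^ (5 * s))%N.
  by apply: leq_trans ns _; rewrite mulnC expnM leq_exp2r // ltn_expl.
have n2 := ltnW n1.
have s_gt0 : (0 < s)%N by apply: leq_trans s0.
have s2 : (256 <= s ^ 2)%N.
  by apply: leq_trans s0 _; rewrite -[leqLHS]expn1 leq_pexp2l.
have s4 : (256 * s ^ 2 <= s ^ 4)%N by rewrite (expnD s 2 2) leq_mul2r s2 orbT.
have s5 : (s ^ 4 <= s ^ 5)%N by rewrite leq_pexp2l.
exists (n./2), (s ^ 4)%N, (s ^ 2)%N, b; rewrite -mul2n; split => //.
  split.
  - by rewrite half_gt0; move: (s ^ 2)%N (s ^ 4)%N (s ^ 5)%N s2 s4 s5 sn; clear => *; lia.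
  - by rewrite -divn2 leq_div.
  - by move: (s ^ 2)%N (s ^ 4)%N s2 s4; clear => *; lia.
set T1 := (X in X + _ + _); set T2 := (X in _ + X + _); set T3 := (X in _ + _ + X).
have hT1 : T1 <= y ^+ (7 * s).
  apply: (@natr_mul_le _ (10 * s)).
    rewrite (_ : 10 * s = 5 * s + 5 * s)%N; last by clear; lia.
    by rewrite expnD leq_mul.
  apply: div_le_half dK _ => //; apply: exprn_le_half cK _ => //.
  by apply: leq_trans B1; rewrite leq_mul2l; clear; lia.
have hT2 : T2 <= y ^+ (7 * s).
  apply: (@natr_mul_le _ (5 * s + 20 * s ^ 3 * n + n)).
    have hp : ((n ^ (2 * s ^ 2)) ^ n <= 2 ^ (10 * s ^ 3 * n))%N.
      rewrite (_ : 10 * s ^ 3 * n = 5 * s * (2 * s ^ 2) * n)%N; last first.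
        by clear; ring.
      have n0 : (0 < n)%N by apply: leq_trans sn; rewrite expn_gt0 s_gt0.
      have s20 : (0 < 2 * s ^ 2)%N by rewrite muln_gt0 expn_gt0 s_gt0.
      by rewrite 2!(expnM 2) leq_exp2r // leq_exp2r.
    apply: leq_trans (leq_mul (leq_mul n2 hp) (leq_mul (leqnn _) hp)) _.
    rewrite -!expnD leq_exp2l // -!(mulnA _ (s ^ 3)%N n).
    by move: (s ^ 3 * n)%N; clear => ?; lia.
  rewrite ler_pdivrMr ?exprn_gt0 //.
  apply: le_trans (_ : y ^+ (K * n + (5 * s + 20 * s ^ 3 * n + n + 7 * s)) <= _).
    exact: exprn_le_half cK B2.
  rewrite exprD mulrC ler_wpM2l ?exprn_ge0 // exprM lerXn2r ?nnegrE ?exprn_ge0 //.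
  exact: ltW.
have hT3 : T3 <= y ^+ (7 * s).
  apply: (natr_mul_le n2); apply: div_le_half dK _ => //.
  have cs0 : 0 <= c ^+ (s ^ 2) by rewrite exprn_ge0.
  (* The factor 4 comes from [(p - 1) * p <= 4 * z] below; the extra 1 in the exponent lets the
     contributions of large and small violators add up to [y ^+ (K + 12 * s)]. *)
  have hA : (4 * n)%:R * c ^+ (s ^ 2) <= y ^+ (K + (12 * s + 1)).
    apply: (@natr_mul_le _ (5 * s + 2)); first by rewrite addnC expnD leq_mul.
    apply: exprn_le_half cK _ => //; apply: leq_trans B3.
    by rewrite leq_mul2l; clear; lia.
  have hB : n%:R * (b ^- (s ^ 4) * (c + b) ^+ n) <= y ^+ (K + (12 * s + 1)).
    apply: (natr_mul_le n2); rewrite mulrC ler_pdivrMr ?exprn_gt0 //.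
    apply: le_trans (_ : y ^+ (K * s ^ 4 + (17 * s + K + 1)) <= _).
      exact: exprn_le_half (ltW cb1) cbK B4.
    rewrite exprD mulrC (_ : 17 * s + K + 1 = 5 * s + (K + (12 * s + 1)))%N; last by clear; lia.
    rewrite ler_wpM2l ?exprn_ge0 // exprM lerXn2r ?nnegrE ?exprn_ge0 //.
    exact: ltW.
  have yle : y ^+ (K + (12 * s + 1)) <= 1 by rewrite exprn_ile1.
  have e4 : (4 * n)%:R * c ^+ (s ^ 2) = 4 * (n%:R * c ^+ (s ^ 2)) by rewrite natrM mulrA.
  have na0 : 0 <= n%:R * c ^+ (s ^ 2) by rewrite mulr_ge0.
  have := exp1D_le (n := n) cs0; rewrite e4 in hA.
  move: (n%:R * c ^+ (s ^ 2)) hA na0 => z hA z0.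
  have ple : 1 <= (1 + c ^+ (s ^ 2)) ^+ n by rewrite exprn_ege1 // lerDl.
  move: ((1 + c ^+ (s ^ 2)) ^+ n) ple => p ple pz.
  have z1 := le_trans hA yle.
  have {}pz : p <= 1 + 2 * z by apply: pz; clear - z1; lra.
  have hp : (p - 1) * p <= 4 * z.
    apply: le_trans (_ : (2 * z) * 2 <= _); last by clear; lra.
    by apply: ler_pM; clear - z1 z0 ple pz; lra.
  rewrite (_ : K + (5 * s + 7 * s) = K + 12 * s)%N in yle *; last by clear; lia.
  have -> : y ^+ (K + 12 * s) = y ^+ (K + (12 * s + 1)) + y ^+ (K + (12 * s + 1)).
    have yy : y + y = 1 by clear; lra.
    by rewrite addnA addn1 exprSr -mulrDr yy mulr1.
  by apply: lerD hB; apply: le_trans hA.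
(* The target [7 * s] suffices since [4 * n.+1] is at most [2 ^ (5 * s + 2)]. *)
apply: le_trans (_ : 4%:R * y ^+ (7 * s) <= _).
  have : 0 <= y ^+ (7 * s) by rewrite exprn_ge0.
  by move: (y ^+ _) T1 T2 T3 hT1 hT2 hT3; clear => *; lra.
rewrite -[leRHS]mul1r ler_pdivlMr ?ltr0n // mulrAC -natrM.
have := @natr_mul_le (4 * n.+1) (5 * s + 2) 0 (y ^+ (7 * s)); rewrite expr0; apply.
  by rewrite addnC expnD leq_mul.
by rewrite ler_wiXn2l //; clear - s0; lia.
Qed.
End Estimates.

(** * From ordered bases to basis sets and transversal partitions *)

(** A map with fibres of constant size carries the uniform law on tuples to the uniform law; it is
    used for forgetting the order of a basis. *)
Lemma comp_count (A B I : finType) (phi : A -> B) (f : nat) (P : pred {ffun I -> B}) :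
  (forall b, #|[set a | phi a == b]| = f) ->
  #|[set Z : {ffun I -> A} | P [ffun i => phi (Z i)]]| =
    (#|[set X | P X]| * f ^ #|I|)%N.
Proof.
move=> fib; rewrite -sum1_card.
rewrite (partition_big (fun Z : {ffun I -> A} => [ffun i => phi (Z i)])
  (mem [set X | P X])) /=; last by move=> Z; rewrite !inE.
rewrite -sum_nat_const; apply: eq_bigr => X; rewrite inE => PX.
rewrite -prod_nat_const -(eq_bigr _ (fun i _ => fib (X i))).
rewrite -card_family_set -sum1_card; apply: eq_bigl => Z; rewrite !inE.
apply/andP/forallP => [[_ /eqP/ffunP e] i|e]; first by have := e i; rewrite ffunE inE => ->.
have -> : [ffun i => phi (Z i)] = X; last by [].
by apply/ffunP => i; rewrite ffunE; have := e i; rewrite inE => /eqP.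
Qed.

Lemma card_fset_pred (K : choiceType) (A : {fset K}) (P : pred K) :
  #|[pred t : A | P (fsval t)]| = #|` [fset v in A | P v]%fset |.
Proof.
rewrite cardE -(size_map (@fsval _ A)); apply: perm_size; apply: uniq_perm.
- by rewrite map_inj_uniq ?enum_uniq //; apply: val_inj.
- exact: fset_uniq.
move=> v; rewrite !inE /=; apply/mapP/andP => [[t + ->]|[vA Pv]].
  by rewrite mem_enum inE => Pt; split => //; apply: fsvalP.
by exists [` vA]%fset; rewrite ?mem_enum ?inE.
Qed.

Section Transfer.
Variables (F : fieldType) (n : nat) (T : {fset 'rV[F]_n}).

Local Notation obasis := (ordered_basis (fun t : T => fsval t) (n := n)).

Lemma dim_rV : \dim {:'rV[F]_n} = n.
Proof. by rewrite dimvf dim_matrix; apply: mul1n. Qed.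

Definition row_vectors (x : {ffun 'I_n -> T}) := [seq fsval (x i) | i <- enum 'I_n].
Lemma size_row_vectors x : size (row_vectors x) = n.
Proof. by rewrite size_map size_enum_ord. Qed.

Definition row_set (x : {ffun 'I_n -> T}) : {fset 'rV[F]_n} :=
  [fset fsval (x i) | i in 'I_n]%fset.

Lemma ordered_basisE (x : {ffun 'I_n -> T}) :
  obasis x = basis_of {:'rV[F]_n} (row_vectors x).
Proof.
rewrite basisEdim size_row_vectors dim_rV leqnn andbT.
rewrite span_def /row_vectors big_map big_enum /= /ordered_basis.
have -> : (\sum_(i in 'I_n) <[fsval (x i)]> = pspan (fun t : T => fsval t) x n)%VS.
  by apply: eq_bigl => i; rewrite ltn_ord.
have [_ <-] := dimv_leqif_sup (subvf (pspan (fun t : T => fsval t) x n)).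
by rewrite dim_rV.
Qed.

Lemma ordered_basis_inj (x : {ffun 'I_n -> T}) : obasis x -> injective x.
Proof.
rewrite ordered_basisE => /basis_free/free_uniq uL i j e.
have nthE (k : 'I_n) : nth 0 (row_vectors x) k = fsval (x k).
  by rewrite (nth_map k) ?size_enum_ord // nth_ord_enum.
apply: ord_inj; apply/eqP; rewrite -(nth_uniq 0 _ _ uL) ?size_row_vectors //.
by rewrite !nthE e.
Qed.

Lemma row_setP (x : {ffun 'I_n -> T}) v :
  reflect (exists i, v = fsval (x i)) (v \in row_set x).
Proof.
by apply: (iffP (imfsetP _ _ _ _)) => [[i _ ->]|[i ->]]; exists i.
Qed.

Lemma row_set_perm (x : {ffun 'I_n -> T}) : injective x ->
  perm_eq (enum_fset (row_set x)) (row_vectors x).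
Proof.
move=> xinj; apply: uniq_perm; first exact: fset_uniq.
  by rewrite map_inj_uniq ?enum_uniq // => i j /val_inj/xinj.
move=> v; apply/row_setP/mapP => [[i ->]|[i _ ->]]; exists i => //.
by rewrite mem_enum.
Qed.

Lemma row_set_basis (x : {ffun 'I_n -> T}) : obasis x -> row_set x \in bases_in T.
Proof.
move=> xb; rewrite !inE /=; apply/andP; split.
  by rewrite fpowersetE; apply/fsubsetP => v /row_setP[i ->]; apply: fsvalP.
rewrite /is_basis (perm_basis _ (row_set_perm (ordered_basis_inj xb))).
by rewrite -ordered_basisE.
Qed.

Lemma card_basis (B : {fset 'rV[F]_n}) : is_basis B -> #|` B| = n.
Proof.
by move=> hB; rewrite -[RHS]dim_rV -(@size_basis _ _ _ _ (in_tuple (enum_fset B)) hB).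
Qed.

(** The orderings of [B] are the injections of ['I_n] into [B]: such an injection is onto by
    cardinality, hence lists a basis. *)
Lemma card_orderings (B : {fset 'rV[F]_n}) : B \in bases_in T ->
  #|[set x : {ffun 'I_n -> T} | obasis x && (row_set x == B)]| = n`!.
Proof.
rewrite !inE /= => /andP[]; rewrite fpowersetE => BT hB.
have cB : #|[pred t : T | fsval t \in B]| = n.
  rewrite -[RHS](card_basis hB) card_fset_pred; congr #|` _|.
  apply/fsetP => v; rewrite !inE /=; apply/andP/idP => [[]//|vB].
  by split => //; apply: (fsubsetP BT).
have <- : #|[set x : {ffun 'I_n -> T} in
    ffun_on [pred t : T | fsval t \in B] | injectiveb x]| = n`!.
  by rewrite card_inj_ffuns_on cB card_ord ffactnn.
apply: eq_card => x; rewrite !inE; apply/andP/andP => -[].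
  move=> xb /eqP <-; split; last exact/injectiveP/ordered_basis_inj.
  by apply/ffun_onP => i; rewrite inE; apply/row_setP; exists i.
move=> /ffun_onP xB /injectiveP xinj.
have eB : row_set x = B.
  apply/eqP; rewrite eqEfcard (card_basis hB); apply/andP; split.
    by apply/fsubsetP => v /row_setP[i ->]; apply: xB.
  by have /perm_size := row_set_perm xinj; rewrite size_row_vectors => ->.
rewrite eB eqxx; split => //; rewrite ordered_basisE.
by rewrite -(perm_basis _ (row_set_perm xinj)) eB.
Qed.

Lemma dispersed_card (R : realType) (c : R) : dispersed c T ->
  forall U : {vspace 'rV[F]_n},
  #|[set t : T | fsval t \in U]|%:R <= c ^+ (n - \dim U) * #|{: T}|%:R.
Proof.
move=> dT U; rewrite cardsE (card_fset_pred T (fun v => v \in U)) -cardfE.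
exact: dT.
Qed.

(** The [j]-th transversal basis is column [j] of the rearranged matrix. As [s i] permutes row [i],
    every copy of every vector occurs in exactly one column. *)
Lemma arranged_partition (X : 'I_n -> {ffun 'I_n -> T}) (s : 'I_n -> 'I_n -> 'I_n) :
  (forall i, injective (X i)) -> (forall i, injective (s i)) ->
  (forall j, \dim (pspan (fun t : T => fsval t) (fun i => X i (s i j)) n) = n) ->
  transversal_basis_partition (fun i => row_set (X i)).
Proof.
move=> Xinj sinj sdim.
pose v i j := fsval (X i (s i j)).
exists (fun j => [fset (i, v i j) | i in 'I_n]%fset).
have memP j i w : reflect (w = v i j) ((i, w) \in [fset (i, v i j) | i in 'I_n]%fset).
  by apply: (iffP (imfsetP _ _ _ _)) => [[k _ [-> ->]] //|->]; exists i.
have multiP i w : reflect (exists j, w = v i j) ((i, w) \in multi_union (fun i => row_set (X i))).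
  apply: (iffP (bigfcupP _ _ _ _)) => [[k _ /imfsetP[w' /= /row_setP[l ->] [-> ->]]]|[j ->]].
    have [s' _ s's] := injF_bij (sinj k).
    by exists (s' l); rewrite /v s's.
  exists i; rewrite ?mem_index_enum //; apply/imfsetP; exists (v i j) => //.
  by apply/row_setP; exists (s i j).
split.
- move=> [i w]; split => [/multiP[j ->]|[j /memP ->]]; first by exists j; apply/memP.
  by apply/multiP; exists j.
- move=> j k jk; apply/fdisjointP => -[i w] /memP ->; apply/memP => /val_inj/Xinj/sinj e.
  by rewrite e eqxx in jk.
- move=> j; rewrite /is_multiset_basis.
  have /perm_basis -> : perm_eq [seq x.2 | x <- enum_fset [fset (i, v i j) | i in 'I_n]%fset]
      (row_vectors [ffun i => X i (s i j)]).
    rewrite (_ : row_vectors _ = [seq x.2 | x <- [seq (i, v i j) | i <- enum 'I_n]]); last first.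
      by rewrite -map_comp; apply: eq_map => i /=; rewrite ffunE.
    apply: perm_map; apply: uniq_perm; first exact: fset_uniq.
      by rewrite map_inj_uniq ?enum_uniq // => i k [].
    move=> [i w]; apply/memP/mapP => [->|[k _ [-> ->]] //]; exists i => //.
    by rewrite mem_enum.
  rewrite -ordered_basisE; apply/eqP; rewrite -[RHS](sdim j); congr (\dim _).
  by apply: eq_pspan => i _; rewrite ffunE.
- move=> j; split.
    apply/fsubsetP => -[i w] /memP ->; apply/multiP; by exists j.
  move=> i; exists (v i j); split => [|w /memP //]; exact/memP.
Qed.
End Transfer.

(* Probabilities and the limit statement *)
From mathcomp Require Import boolp classical_sets reals topology normedtype sequences.
Import numFieldNormedType.Exports.

Lemma prob_indep_uniformE (R : realType) (K : choiceType) (n : nat) (S : {fset K})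
    (E : ('I_n -> K) -> Prop) :
  prob_indep_uniform R S E =
    #|[set X : {ffun 'I_n -> S} | `[< E (fun i => fsval (X i)) >]]|%:R
      / #|{ffun 'I_n -> S}|%:R.
Proof.
rewrite /prob_indep_uniform (eq_bigr (fun=> #|{ffun 'I_n -> S}|%:R^-1)) => [|X _].
  by rewrite sumr_const mulr_natl; congr (_ *+ _); apply: eq_card => X; rewrite inE.
rewrite (eq_bigr (fun=> #|{: S}|%:R^-1)) => [|i _]; last first.
  by rewrite /uniform_pmf fsvalP cardfE.
by rewrite prodr_const card_ffun card_ord natrX exprVn.
Qed.

Section Probability.
Variables (R : realType) (F : fieldType) (n : nat) (T : {fset 'rV[F]_n}).
Local Notation u := (fun t : T => fsval t).

Definition basis_set (r : basis_row u n) : bases_in T :=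
  [` row_set_basis (valP r)]%fset.

Lemma card_basis_set_fiber (B : bases_in T) :
  #|[set r | basis_set r == B]| = n`!.
Proof.
rewrite -(card_orderings (fsvalP B)) -(card_imset _ val_inj).
apply: eq_card => x; rewrite !inE.
apply/imsetP/andP => [[r + ->]|[xb xB]].
  by rewrite inE => /eqP <-; split => //; apply: (valP r).
by exists (exist _ x xb) => //; rewrite inE -val_eqE.
Qed.

Lemma prob_partition_ge (N : nat) (eps : R) : (0 < #|{: basis_row u n}|)%N ->
  #|[set X : {ffun 'I_n -> basis_row u n} | ~~ [exists s, arranged N n X s]]|%:R <=
    eps * #|{ffun 'I_n -> basis_row u n}|%:R ->
  1 - eps <= prob_indep_uniform R (bases_in T) (@transversal_basis_partition F n).
Proof.
move=> row0 le_eps; rewrite prob_indep_uniformE.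
set good := [set X | _]; pose E X := X \in good.
have countE P := @comp_count _ _ 'I_n _ _ P card_basis_set_fiber.
have f0 : 0 < (n`! ^ n)%N%:R :> R by rewrite ltr0n expn_gt0 fact_gt0.
have tot : #|{ffun 'I_n -> basis_row u n}| = (#|{ffun 'I_n -> bases_in T}| * n`! ^ n)%N.
  have all (A : finType) : #|[set x : A | true]| = #|A|.
    by apply: eq_card => x; rewrite inE.
  by have := countE xpredT; rewrite card_ord !all.
have bad_le : #|~: good|%:R <= eps * #|{ffun 'I_n -> bases_in T}|%:R.
  rewrite -(ler_pM2r f0) -mulrA -!natrM -tot; apply: le_trans le_eps.
  rewrite ler_nat -[X in (n`! ^ X)%N]card_ord.
  have -> : ~: good = [set X | predC (mem good) X] by apply/setP => X; rewrite !inE.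
  rewrite -countE; apply/subset_leq_card/fintype.subsetP => Z; rewrite !inE.
  apply: contra => /existsP[s /and3P[sinj _ sdim]]; apply/asboolP.
  have -> : (fun i => fsval ([ffun i => basis_set (Z i)] i)) =
            (fun i => row_set (val (Z i))) by apply/funext => i; rewrite ffunE.
  apply: (@arranged_partition _ _ _ _ (fun i => s i)) => [i|i|j].
  - exact/ordered_basis_inj/(valP (Z i)).
  - exact/injectiveP/(forallP sinj).
  - exact/eqP/(forallP sdim).
have tot0 : 0 < #|{ffun 'I_n -> bases_in T}|%:R :> R.
  have : (0 < #|{ffun 'I_n -> basis_row u n}|)%N by rewrite card_ffun expn_gt0 row0.
  by rewrite tot muln_gt0 ltr0n => /andP[].
rewrite ler_pdivlMr // mulrBl mul1r lerBlDr.
apply: le_trans (lerD (lexx _) bad_le).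
by rewrite -natrD cardsC.
Qed.

End Probability.

Local Open Scope classical_set_scope.
Local Open Scope ring_scope.

Theorem theorem1p5 (R : realType) (F : fieldType) (c : R)
    (hc0 : 0 < c) (hc1 : c < 1) :
  exists e : nat -> R,
    (e n @[n --> \oo] --> (0 : R)) /\
    forall (n : nat) (T : {fset 'rV[F]_n}),
      T != fset0 -> dispersed c T ->
      1 - e n <= prob_indep_uniform R (bases_in T)
                   (@transversal_basis_partition F n).
Proof.
have [delta d0 hdelta] := prod_1mexp_ge hc0 hc1.
have [n0 hn0] := failure_bound hc0 hc1 d0.
(* The numerator makes the error at least 1 for [n < n0], where the claim becomes trivial; from [n0]
   on the failure bound [n.+1%:R^-1] is smaller still. *)
exists (fun n => n0.+1%:R * n.+1%:R^-1); split.
  rewrite -[X in _ --> X](mulr0 n0.+1%:R); apply: cvgMr; exact: cvg_harmonic.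
move=> n T T0 dT; have [nn0|nn0] := ltnP n n0.
  apply: (@le_trans _ _ 0).
    by rewrite subr_le0 ler_pdivlMr ?ltr0n // mul1r ler_nat ltnS ltnW.
  by rewrite prob_indep_uniformE divr_ge0.
have [N [g [h [b [[N0 Nn hg] b0 b1 bound]]]]] := hn0 n nn0.
have cT0 : (0 < #|{: T}|)%N by rewrite -cardfE cardfs_gt0.
have disp := dispersed_card dT.
have dle : delta * #|{: T}|%:R ^+ n <= 
    #|[set x | ordered_basis (fun t : T => fsval t) (n := n) x]%SET|%:R.
  have cnt := ordered_basis_count (dim_rV F n) cT0 hc0 hc1 disp.
  apply: le_trans cnt.
  by rewrite ler_wpM2r ?exprn_ge0.
have row0 := card_basis_row_gt0 cT0 d0 dle.
apply: (prob_partition_ge (N := N)) => //.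
apply: le_trans (unarranged_count (dim_rV F n) cT0 hc0 hc1 disp d0 dle N0 Nn hg b0 b1) _.
rewrite ler_wpM2r //; apply: le_trans bound _.
by rewrite ler_peMl ?invr_ge0 // ler1n.
Qed.
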